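(* Suppose $A\in\mathbb{C}^{n\times n}$ with $\|A\|\le 1$ and $\delta\in(0,1)$. Let $G_n$ be an $n\times n$ complex Ginibre matrix, and let $\lambda_1,\ldots,\lambda_n\in\mathbb{C}$ be the (random) eigenvalues of $A+\delta G_n$. Then for every measurable open set $B\subset\mathbb{C}$, $$\mathbb{E}\sum_{\lambda_i\in B}\kappa(\lambda_i)^2\le\frac{n^2}{\pi\delta^2}\,\mathrm{vol}(B).$$
   Context: $\|\cdot\|$ denotes the operator norm on matrices and the Euclidean norm on vectors; $\mathrm{vol}$ denotes Lebesgue measure on $\mathbb{C}\cong\mathbb{R}^2$. A complex Ginibre matrix is an $n\times n$ random matrix $G_n=(g_{ij})$ whose entries are i.i.d. complex Gaussians $N(0,1_{\mathbb{C}}/n)$, i.e. the real and imaginary parts of all entries are independent real Gaussians with mean $0$ and variance $1/(2n)$ (so $\mathbb{E}g_{ij}=0$, $\mathbb{E}|g_{ij}|^2=1/n$). For a matrix $M\in\mathbb{C}^{n\times n}$ with distinct eigenvalues $\lambda_1,\ldots,\lambda_n$, write $M=\sum_{i=1}^n\lambda_i v_iw_i^*=VDV^{-1}$, where the right and left eigenvectors $v_i$ and $w_i^*$ are the columns of $V$ and the rows of $V^{-1}$, respectively, normalized so that $w_i^*v_i=1$. The eigenvalue condition number of $\lambda_i$ is $\kappa(\lambda_i)=\|v_iw_i^*\|=\|v_i\|\,\|w_i\|$. The $\kappa(\lambda_i)$ in the claim are those of $M=A+\delta G_n$, which has distinct eigenvalues with probability one. *)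

(* Defs.v *)
From mathcomp Require Import all_boot all_order all_algebra.
From mathcomp Require Import complex.
From mathcomp Require Import all_classical all_reals all_analysis.

Set Implicit Arguments.
Unset Strict Implicit.
Unset Printing Implicit Defensive.

Import Order.TTheory GRing.Theory Num.Theory numFieldNormedType.Exports.

Local Open Scope classical_set_scope.
Local Open Scope ring_scope.
Local Open Scope complex_scope.

Definition euclid_norm (R : realType) (m : nat) (v : 'cV[R[i]]_m) : R :=
  Num.sqrt (\sum_(i < m) (complex.Re (v i 0) ^+ 2 + complex.Im (v i 0) ^+ 2)).

Definition op_norm (R : realType) (m n : nat) (M : 'M[R[i]]_(m, n)) : R :=
  sup [set euclid_norm (M *m x) | x in [set x : 'cV[R[i]]_n | euclid_norm x <= 1]].

(* The eigenvalues, listed with algebraic multiplicity. *)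
Definition eigenvalues (R : realType) (n : nat) (M : 'M[R[i]]_n)
    (lam : 'I_n -> R[i]) : Prop :=
  char_poly M = \prod_(i < n) ('X - (lam i)%:P).

(* M = V D V^-1 with D diagonal and pairwise distinct eigenvalues D 0 i. *)
Definition distinct_diagonalization (R : realType) (n : nat) (M V : 'M[R[i]]_n)
    (D : 'rV[R[i]]_n) : Prop :=
  [/\ V \in unitmx, injective (D 0) & M = V *m diag_mx D *m invmx V].

(* When M has distinct eigenvalues and l is one of them, the set below is a
   singleton (see eig_condE).  In every other case it is empty and the value is
   +oo, so that an upper bound never holds by convention. *)
Definition eig_cond (R : realType) (n : nat) (M : 'M[R[i]]_n) (l : R[i]) : \bar R :=
  xget +oo%E [set k | exists (V : 'M[R[i]]_n) (D : 'rV[R[i]]_n) (i : 'I_n),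
    [/\ distinct_diagonalization M V D, D 0 i = l &
        k = (op_norm (col i V *m row i (invmx V)))%:E]].

(* Mutual independence of a finite family of real random variables. *)
Definition mutually_independent (d : measure_display) (T : measurableType d)
    (R : realType) (P : probability T R) (I : finType) (X : I -> T -> R) : Prop :=
  forall (J : {set I}) (E : I -> set R), (forall k, measurable (E k)) ->
    P (\bigcap_(k in [set` J]) (X k @^-1` E k)) =
    (\prod_(k in J) P (X k @^-1` E k))%E.

(* The real (false) and imaginary (true) parts of the entries. *)
Definition real_coord (R : realType) (T : Type) (n : nat) (G : T -> 'M[R[i]]_n)
    (k : 'I_n * 'I_n * bool) (w : T) : R :=
  let z := G w k.1.1 k.1.2 in if k.2 then complex.Im z else complex.Re z.

(* The second parameter of normal_prob is the standard deviation. *)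
Record ginibre (d : measure_display) (T : measurableType d) (R : realType)
    (P : probability T R) (n : nat) (G : T -> 'M[R[i]]_n) : Prop := Ginibre {
  ginibre_measurable : forall k, measurable_fun setT (real_coord G k);
  ginibre_law : forall k (E : set R), measurable E ->
    P (real_coord G k @^-1` E) = normal_prob 0 (Num.sqrt ((2 * n%:R)^-1)) E;
  ginibre_independent : mutually_independent P (real_coord G) }.

Definition vol (R : realType) (B : set R[i]) : \bar R :=
  (@lebesgue_measure R \x @lebesgue_measure R)%E [set p : R * R | B (p.1 +i* p.2)].

Lemma distinct_diagonalization_proj (R : realType) (n : nat)
    (M V V' : 'M[R[i]]_n) (D D' : 'rV[R[i]]_n) (i j : 'I_n) :
  distinct_diagonalization M V D -> distinct_diagonalization M V' D' ->
  D 0 i = D' 0 j ->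
  col i V *m row i (invmx V) = col j V' *m row j (invmx V').
Proof.
move=> [Vu Di ->] [V'u D'i E] Dij; pose W := invmx V *m V'.
have WD : diag_mx D *m W = W *m diag_mx D'.
  have -> : W *m diag_mx D' = invmx V *m (V' *m diag_mx D' *m invmx V') *m V'.
    by rewrite /W !mulmxA mulmxKV.
  by rewrite -E /W !mulmxA mulVmx// mul1mx.
have VW : V' = V *m W by rewrite /W mulKVmx.
have Wu : W \in unitmx by rewrite unitmx_mul unitmx_inv Vu.
clearbody W; have W0 a b : D 0 a != D' 0 b -> W a b = 0.
  move=> ab; have /matrixP/(_ a b) := WD.
  rewrite mul_diag_mx mul_mx_diag !mxE mulrC => /eqP.
  rewrite -subr_eq0 -mulrBr mulf_eq0 subr_eq0 (negbTE ab) orbF => /eqP.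
  by [].
have Wdelta : W *m delta_mx j j = delta_mx i i *m W.
  apply/matrixP => a b; rewrite !mxE (bigD1 j)//= big1 => [|k kj]; last first.
    by rewrite [delta_mx j j _ _]mxE (negbTE kj) mulr0.
  rewrite (bigD1 i)//= big1 => [|k ki]; last first.
    by rewrite [delta_mx i i _ _]mxE (negbTE ki) andbF mul0r.
  rewrite ![delta_mx _ _ _ _]mxE !eqxx andbT /= !addr0.
  have [->|ai] := eqVneq a i; have [->|bj] := eqVneq b j;
    rewrite ?mulr1 ?mul1r ?mulr0 ?mul0r//.
  - by rewrite W0// Dij; apply: contra_neq bj => /D'i.
  - by rewrite W0// -Dij; apply: contra_neq ai => /Di.
rewrite !colE !rowE.
have dd (k : 'I_n) : delta_mx k 0 *m delta_mx 0 k = delta_mx k k :> 'M[R[i]]_n.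
  by rewrite mul_delta_mx.
rewrite !mulmxA -(mulmxA V) -(mulmxA V') !dd.
rewrite VW.
have -> : V *m W *m delta_mx j j = V *m delta_mx i i *m W.
  by rewrite -!mulmxA Wdelta.
have -> : invmx (V *m W) = invmx W *m invmx V.
  apply: (can_inj (mulKmx (_ : V *m W \in unitmx))); first by rewrite unitmx_mul Vu.
  by rewrite mulmxV ?unitmx_mul ?Vu// mulmxA mulmxK// mulmxV.
by rewrite !mulmxA mulmxK.
Qed.

Lemma eig_condE (R : realType) (n : nat) (M V : 'M[R[i]]_n) (D : 'rV[R[i]]_n)
    (i : 'I_n) : distinct_diagonalization M V D ->
  eig_cond M (D 0 i) = (op_norm (col i V *m row i (invmx V)))%:E.
Proof.
move=> MVD; rewrite /eig_cond; case: xgetP => [k _ [V' [D' [j [MVD' Dij ->]]]]|].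
  by rewrite (distinct_diagonalization_proj MVD' MVD Dij).
by move=> /(_ (op_norm (col i V *m row i (invmx V)))%:E)[]; exists V, D, i.
Qed.

(* Main.v *)
(** The resolvent of a matrix [M] with distinct eigenvalues behaves like
    [v_i w_i^* / (lambda_i - z)] near [lambda_i], so the squared norm [X_j(z)] of
    its [j]-th row behaves like [|v_i(j)|^2 |w_i|^2 / |lambda_i - z|^2].  Hence
    [s^-2 / pi * \int_B exp (- 1 / (s^2 X_j(z))) dz] concentrates at the
    eigenvalues as [s -> 0], and its lower limit is at least the sum over
    [lambda_i] in [B] of [|v_i(j)|^2 |w_i|^2]; summing over [j] gives the sum of
    the [kappa(lambda_i)^2].  By Fatou and Tonelli it remains to bound
    [E exp (- 1 / (s^2 X_j(z)))] for fixed [z].  Now [1 / X_j(z) = |det|^2 / |a|^2],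
    where [a] is the vector of cofactors along column [j] of [A + delta G - z].
    It does not depend on column [j], while the determinant is affine in that column with
    coefficients [a], so the expectation over column [j] is an explicit Gaussian
    integral, at most [s^2 n / delta^2].

    Eigenvalues are almost surely distinct because a nonzero polynomial in the
    entries vanishes with probability zero. *)

From HB Require Import structures.
Require Import Defs.
From mathcomp Require Import all_boot all_order all_algebra.
From mathcomp Require Import complex ring lra.
From mathcomp Require Import all_classical all_reals all_analysis measurable_realfun.

Set Implicit Arguments.
Unset Strict Implicit.
Unset Printing Implicit Defensive.

Import Order.TTheory GRing.Theory Num.Theory numFieldNormedType.Exports.
Import HBNNSimple.

Local Open Scope classical_set_scope.
Local Open Scope ring_scope.
Local Open Scope complex_scope.

(** * Gaussian integrals on the line *)

(** The exponential test is chosen because the determinant is Gaussian in one column: integrating a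
    single entry out of [exp (- |det|^2 / t)] returns a function of the same shape with a larger
    [t], so a whole column is handled by induction. With [S = |a|^2], [t = s^2 S] and entries of
    variance [1/n], the expectation over the column is at most [t / (t + delta^2 S / n)]. Here [S]
    cancels, which makes the bound uniform in [A], in [z] and in the other columns. The factor
    [s^-2 / pi] is dictated by the planar integral of [exp (- |z - lambda|^2 / (s^2 c))], which is
    [pi s^2 c]. Each of the [n] rows then contributes [n vol(B) / (pi delta^2)]. The obstacle is
    measurability: the eigenvalues are an arbitrary choice at each sample point, and the condition
    numbers are defined through a diagonalization. All probability is therefore done on the tests,
    which are explicit functions of the entries; the condition numbers enter only through a
    pointwise inequality outside a null event. *)

Lemma ge0_integral_normal_prob (R : realType) (m s : R) (f : measurableTypeR R -> \bar R) :
  measurable_fun setT f -> (forall x, 0 <= f x)%E ->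
  (\int[normal_prob m s]_x f x =
   \int[lebesgue_measure]_x (f x * (normal_pdf m s x)%:E))%E.
Proof.
move=> mf f0; pose h := nnsfun_approx measurableT mf.
have fE x : f x = limn (fun k => (h k x)%:E).
  by apply/esym/cvg_lim => //; apply: cvg_nnsfun_approx.
have mh k : measurable_fun setT (fun x : measurableTypeR R => (h k x)%:E).
  by apply/measurable_EFinP; exact: (measurable_funPT (h k)).
have mp : measurable_fun setT (fun x : measurableTypeR R => (normal_pdf m s x)%:E).
  by apply/measurable_EFinP; exact: measurable_normal_pdf.
(* Both sides commute with the increasing limit of the simple functions [h k], and on an indicator
   the formula is the definition of [normal_prob]. *)
transitivity (limn (fun k => \int[normal_prob m s]_x (h k x)%:E)%E).
  rewrite -monotone_convergence//.
  - by apply: eq_integral => x _; exact: fE.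
  - by move=> k x _; rewrite lee_fin.
  - by move=> x _ a b ab; rewrite lee_fin; exact/lefP/nd_nnsfun_approx.
transitivity (limn (fun k =>
    \int[lebesgue_measure]_x ((h k x)%:E * (normal_pdf m s x)%:E))%E); last first.
  rewrite -monotone_convergence//.
  - apply: eq_integral => x _; rewrite fE; apply/cvg_lim => //.
    by apply: cvgeZr => //; rewrite -fE; exact: cvg_nnsfun_approx.
  - by move=> k; apply: emeasurable_funM; [exact: mh|exact: mp].
  - by move=> k x _; rewrite mule_ge0 ?lee_fin ?normal_pdf_ge0.
  - move=> x _ a b ab; rewrite lee_wpmul2r ?lee_fin ?normal_pdf_ge0//.
    exact/lefP/nd_nnsfun_approx.
congr (limn _); apply/funext => k.
under eq_integral do rewrite fimfunE -fsumEFin//.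
rewrite ge0_integral_fsum//; last 2 first.
- by move=> y; exact/measurable_EFinP/measurable_funM.
- by move=> y x _; rewrite nnfun_muleindic_ge0.
transitivity (\int[lebesgue_measure]_x (\sum_(r \in range (h k))
     ((r * \1_(h k @^-1` [set r]) x)%:E * (normal_pdf m s x)%:E)))%E; last first.
  apply: eq_integral => x _; rewrite [X in _ = (X%:E * _)%E]fimfunE -fsumEFin// ge0_mule_fsuml//.
  by move=> r; rewrite nnfun_muleindic_ge0.
rewrite ge0_integral_fsum//; last 2 first.
- by move=> r; apply: emeasurable_funM => //; exact/measurable_EFinP/measurable_funM.
- by move=> r x _; rewrite mule_ge0 ?nnfun_muleindic_ge0 ?lee_fin ?normal_pdf_ge0.
apply: eq_fsbigr => r; rewrite inE => -[x _ <-].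
under eq_integral do rewrite EFinM.
rewrite ge0_integralZl//; last 2 first.
- exact/measurable_EFinP.
- by rewrite lee_fin.
under [RHS]eq_integral do rewrite EFinM -muleA.
rewrite ge0_integralZl//; last 3 first.
- by apply: emeasurable_funM => //; exact/measurable_EFinP.
- by move=> y _; rewrite mule_ge0 ?lee_fin ?normal_pdf_ge0.
- by rewrite lee_fin.
rewrite integral_indic// setIT; congr (_ * _)%E.
rewrite [LHS]integral_mkcond; apply: eq_integral => y _.
rewrite patchE indicE; case: ifPn => [|_]; first by rewrite mul1e.
by rewrite mul0e.
Qed.

(** Completing the square: with [q = 1 + 2 c v], the integrand times the density is a constant
    multiple of the normal density of mean [- 2 c v b / q] and variance [v / q], whose mass is 1. *)
Lemma integral_normal_gauss (R : realType) (v c b : R) : 0 < v -> 0 <= c ->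
  (\int[normal_prob 0%R (Num.sqrt v)]_x (expR (- (c * (b + x) ^+ 2)))%:E =
   ((Num.sqrt (1 + 2 * c * v))^-1 * expR (- (c * b ^+ 2 / (1 + 2 * c * v))))%:E)%E.
Proof.
move=> v0 c0; set q := 1 + 2 * c * v.
have q0 : 0 < q by rewrite /q ltr_wpDr// !mulr_ge0// ltW.
have mG : measurable_fun setT (fun x : measurableTypeR R => (expR (- (c * (b + x) ^+ 2)))%:E).
  apply/measurable_EFinP; apply: measurableT_comp => //; apply: measurableT_comp => //.
  by apply: measurable_funM => //; apply: measurable_funX; exact: measurable_funD.
rewrite ge0_integral_normal_prob//.
have sv0 : Num.sqrt v != 0 by rewrite sqrtr_eq0 -ltNge.
have svq0 : Num.sqrt (v / q) != 0 by rewrite sqrtr_eq0 -ltNge divr_gt0.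
pose m := - (2 * c * v * b / q).
transitivity (\int[lebesgue_measure]_x
   (((Num.sqrt q)^-1 * expR (- (c * b ^+ 2 / q)))%:E *
    (normal_pdf m (Num.sqrt (v / q)) x)%:E))%E; last first.
  rewrite ge0_integralZl//; last 2 first.
  - by apply/measurable_EFinP; exact: measurable_normal_pdf.
  - by move=> x _; rewrite lee_fin normal_pdf_ge0.
  by rewrite integral_normal_pdf mule1.
apply: eq_integral => x _; rewrite -!EFinM; congr _%:E.
rewrite !normal_pdfE// /normal_peak /normal_fun !sqr_sqrtr ?divr_ge0 ?ltW//.
have -> : (Num.sqrt (v * pi *+ 2))^-1 = (Num.sqrt q)^-1 * (Num.sqrt (v / q * pi *+ 2))^-1.
  rewrite -invfM -sqrtrM ?ltW//; congr ((Num.sqrt _)^-1).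
  by field; rewrite gt_eqF.
rewrite mulrCA [RHS]mulrACA; congr (_ * _); rewrite -!expRD; congr expR.
rewrite subr0 /m /q; field.
by rewrite -/q !gt_eqF.
Qed.

(** * Resampling one real coordinate of a Ginibre matrix *)

Definition cmeasurable (d : measure_display) (S : measurableType d) (R : realType)
    (f : S -> R[i]) : Prop :=
  measurable_fun setT (fun s => complex.Re (f s)) /\
  measurable_fun setT (fun s => complex.Im (f s)).

Lemma ReM (R : realType) (x y : R[i]) :
  complex.Re (x * y) = complex.Re x * complex.Re y - complex.Im x * complex.Im y.
Proof. by case: x y => [a b] [c d]. Qed.

Lemma ImM (R : realType) (x y : R[i]) :
  complex.Im (x * y) = complex.Re x * complex.Im y + complex.Im x * complex.Re y.
Proof. by case: x y => [a b] [c d]. Qed.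

Section complex_measurability.
Context (d : measure_display) (S : measurableType d) (R : realType).
Implicit Types f g : S -> R[i].

Lemma cmeasurable_cst (c : R[i]) : cmeasurable (fun _ : S => c).
Proof. by split; exact: measurable_cst. Qed.

Lemma cmeasurableD f g : cmeasurable f -> cmeasurable g ->
  cmeasurable (fun s => f s + g s).
Proof.
move=> [fr fi] [gr gi]; split.
- by under eq_fun do rewrite raddfD; exact: measurable_funD.
- by under eq_fun do rewrite raddfD; exact: measurable_funD.
Qed.

Lemma cmeasurableM f g : cmeasurable f -> cmeasurable g ->
  cmeasurable (fun s => f s * g s).
Proof.
move=> [fr fi] [gr gi]; split.
- under eq_fun do rewrite ReM.
  by apply: measurable_funB; exact: measurable_funM.
- under eq_fun do rewrite ImM.
  by apply: measurable_funD; exact: measurable_funM.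
Qed.

Lemma cmeasurableN f : cmeasurable f -> cmeasurable (fun s => - f s).
Proof.
move=> mf; under eq_fun do rewrite -mulN1r.
exact: cmeasurableM (cmeasurable_cst _) mf.
Qed.

Lemma cmeasurable_sum (I : Type) (r : seq I) (Q : pred I) (f : I -> S -> R[i]) :
  (forall i, Q i -> cmeasurable (f i)) -> cmeasurable (fun s => \sum_(i <- r | Q i) f i s).
Proof.
move=> mf; elim: r => [|i r IH].
  by under eq_fun do rewrite big_nil; exact: cmeasurable_cst.
under eq_fun do rewrite big_cons.
by case Qi: (Q i) => //; apply: cmeasurableD => //; exact: mf.
Qed.

Lemma cmeasurable_prod (I : Type) (r : seq I) (Q : pred I) (f : I -> S -> R[i]) :
  (forall i, Q i -> cmeasurable (f i)) -> cmeasurable (fun s => \prod_(i <- r | Q i) f i s).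
Proof.
move=> mf; elim: r => [|i r IH].
  by under eq_fun do rewrite big_nil; exact: cmeasurable_cst.
under eq_fun do rewrite big_cons.
by case Qi: (Q i) => //; apply: cmeasurableM => //; exact: mf.
Qed.

Lemma cmeasurable_det n (M : S -> 'M[R[i]]_n) :
  (forall i j, cmeasurable (fun s => M s i j)) -> cmeasurable (fun s => \det (M s)).
Proof.
move=> mM; apply: cmeasurable_sum => s _; apply: cmeasurableM.
  exact: cmeasurable_cst.
by apply: cmeasurable_prod => i _.
Qed.

Lemma cmeasurable_cofactor n (M : S -> 'M[R[i]]_n) i j :
  (forall i j, cmeasurable (fun s => M s i j)) ->
  cmeasurable (fun s => cofactor (M s) i j).
Proof.
move=> mM; apply: cmeasurableM; first exact: cmeasurable_cst.
by apply: cmeasurable_det => a b; under eq_fun do rewrite !mxE.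
Qed.

End complex_measurability.

Definition sqn (R : realType) (z : R[i]) : R := complex.Re z ^+ 2 + complex.Im z ^+ 2.

Lemma measurable_sqn (d : measure_display) (S : measurableType d) (R : realType)
  (f : S -> R[i]) : cmeasurable f -> measurable_fun setT (fun s => sqn (f s)).
Proof. by case=> fr fi; apply: measurable_funD; exact: measurable_funX. Qed.

Lemma sqn_ge0 (R : realType) (z : R[i]) : 0 <= sqn z.
Proof. by rewrite addr_ge0// sqr_ge0. Qed.

Lemma sqn_eq0 (R : realType) (z : R[i]) : (sqn z == 0) = (z == 0).
Proof. by case: z => a b; rewrite /sqn paddr_eq0 ?sqr_ge0// !sqrf_eq0 eq_complex. Qed.

Lemma sqn0 (R : realType) : sqn (0 : R[i]) = 0.
Proof. by apply/eqP; rewrite sqn_eq0. Qed.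

Lemma sqnM (R : realType) (x y : R[i]) : sqn (x * y) = sqn x * sqn y.
Proof. by case: x y => [a b] [c d]; rewrite /sqn/=; ring. Qed.

Definition set_coord (R : realType) n (k : 'I_n * 'I_n * bool) (x : R) (M : 'M[R[i]]_n) :
    'M[R[i]]_n :=
  \matrix_(i, j) if (i, j) == k.1 then
      if k.2 then complex.Re (M i j) +i* x else x +i* complex.Im (M i j)
    else M i j.

Lemma real_coord_set (R : realType) (T : Type) n (k j : 'I_n * 'I_n * bool) (x : T -> R)
    (M : T -> 'M[R[i]]_n) w :
  real_coord (fun w => set_coord k (x w) (M w)) j w =
  if j == k then x w else real_coord M j w.
Proof.
case: j => [[a b] c]; case: k => [[a' b'] c']; rewrite /real_coord !mxE/=.
rewrite [in RHS]xpair_eqE; case: eqP => //= _.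
by case: c; case: c'.
Qed.

Lemma set_coord_real_coord (R : realType) n (k : 'I_n * 'I_n * bool) (M : 'M[R[i]]_n) :
  set_coord k (real_coord id k M) M = M.
Proof.
apply/matrixP => i j; rewrite mxE; case: k => [[a b] c]/=.
by case: eqP => // -[-> ->]; rewrite /real_coord/=; case: c; case: (M a b).
Qed.

(* Quantifying over every measurable space makes this notion stable under
   integrating out a coordinate, without a sigma-algebra on matrices. *)
Definition coord_measurable (R : realType) n (Phi : 'M[R[i]]_n -> \bar R) : Prop :=
  forall (d : measure_display) (S : measurableType d) (M : S -> 'M[R[i]]_n),
    (forall k, measurable_fun setT (real_coord M k)) ->
    measurable_fun setT (fun s => Phi (M s)).

Lemma cmeasurable_entry (d : measure_display) (S : measurableType d) (R : realType) n
    (M : S -> 'M[R[i]]_n) i j :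
  (forall k, measurable_fun setT (real_coord M k)) -> cmeasurable (fun s => M s i j).
Proof. by move=> mM; split; [exact: (mM (i, j, false))|exact: (mM (i, j, true))]. Qed.

(** When [s] is the standard deviation of the entries, this is the conditional expectation given the
    coordinates other than [k]. As an operator on functions of a deterministic matrix it can be
    iterated without reference to the sample space. *)
Definition resample (R : realType) (s : R) n (k : 'I_n * 'I_n * bool)
    (Phi : 'M[R[i]]_n -> \bar R) (M : 'M[R[i]]_n) : \bar R :=
  (\int[normal_prob 0%R s]_x Phi (set_coord k x M))%E.

Lemma measurable_set_coord (d : measure_display) (S : measurableType d) (R : realType) n
    (k : 'I_n * 'I_n * bool) (x : S -> R) (M : S -> 'M[R[i]]_n) j :
  measurable_fun setT x -> (j != k -> measurable_fun setT (real_coord M j)) ->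
  measurable_fun setT (real_coord (fun s => set_coord k (x s) (M s)) j).
Proof.
move=> mx mM; rewrite (_ : real_coord _ _ = fun s => if j == k then x s else real_coord M j s).
  by case: eqVneq => [//|/mM].
by apply/funext => w; rewrite real_coord_set.
Qed.

(** The hypothesis on [Phi] is used on the product of the line with [S], which gives joint
    measurability; Tonelli does the rest. *)
Lemma coord_measurable_resample (R : realType) (s : R) n (k : 'I_n * 'I_n * bool)
    (Phi : 'M[R[i]]_n -> \bar R) :
  (forall M, 0 <= Phi M)%E -> coord_measurable Phi -> coord_measurable (resample s k Phi).
Proof.
move=> Phi0 mPhi d S M mM.
pose h (p : measurableTypeR R * S) := Phi (set_coord k p.1 (M p.2)).
have mh : measurable_fun setT h.
  apply: mPhi => j; apply: measurable_set_coord => [|_].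
    exact: measurable_fst.
  exact: (measurableT_comp (mM j) measurable_snd).
apply: (@measurable_fun_fubini_tonelli_G _ _ (measurableTypeR R) S R (normal_prob 0 s) h mh).
by move=> p; exact: Phi0.
Qed.

Lemma resample_ge0 (R : realType) (s : R) n (k : 'I_n * 'I_n * bool)
    (Phi : 'M[R[i]]_n -> \bar R) M :
  (forall M, 0 <= Phi M)%E -> (0 <= resample s k Phi M)%E.
Proof. by move=> Phi0; exact: integral_ge0. Qed.

Section resampling.
Context (d : measure_display) (T : measurableType d) (R : realType).
Context (P : probability T R) (n : nat) (G : T -> 'M[R[i]]_n) (s : R).
Hypothesis mG : forall k, measurable_fun setT (real_coord G k).
Hypothesis lawG : forall k (E : set R), measurable E ->
  P (real_coord G k @^-1` E) = normal_prob 0 s E.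
Hypothesis indepG : mutually_independent P (real_coord G).
Variable k : 'I_n * 'I_n * bool.

(** A family closed under intersection that generates the sigma-algebra of the coordinates other
    than [k]. *)
Let cylinders : set (set T) :=
  [set A | exists (J : {set 'I_n * 'I_n * bool}) (E : 'I_n * 'I_n * bool -> set R),
    [/\ k \notin J, forall j, measurable (E j) &
        A = \bigcap_(j in [set` J]) (real_coord G j @^-1` E j)]].

Let measurable_coord j (E : set R) : measurable E -> measurable (real_coord G j @^-1` E).
Proof. by move=> mE; rewrite -[X in measurable X]setTI; exact: mG. Qed.

Let measurable_cylinders : cylinders `<=` measurable.
Proof.
move=> A [J [E [_ mE ->]]]; apply: fin_bigcap_measurable => // j _.
exact: measurable_coord.
Qed.

Let setI_cylinders : setI_closed cylinders.
Proof.
move=> A B [J [E [kJ mE ->]]] [J' [E' [kJ' mE' ->]]].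
(* Each of the two families of constraints is padded with [setT] outside its own index set. *)
pose F j := (if j \in J then E j else setT) `&` (if j \in J' then E' j else setT).
exists (J :|: J')%SET, F; split.
- by rewrite inE negb_or kJ.
- by move=> j; apply: measurableI; case: ifP.
- apply/seteqP; split => w /=.
    move=> [wE wE'] j /=; rewrite inE /F => _; split.
      by case: ifP => // /wE.
    by case: ifP => // /wE'.
  move=> wF; split=> j /= jJ; have := wF j; rewrite /= inE jJ ?orbT => /(_ isT) [].
    by rewrite jJ.
  by rewrite jJ.
Qed.

(** For fixed [E] both sides are finite measures in [A]. Independence, applied to [J] and to [J]
    enlarged by [k], makes them agree on the cylinders, and a finite measure is determined by a
    generating family closed under intersection. *)
Let indep_cylinder (E : set R) (A : set T) : measurable E -> <<s cylinders >> A ->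
  P (A `&` real_coord G k @^-1` E) = (normal_prob 0%R s E * P A)%E.
Proof.
move=> mE sA.
have fE : normal_prob 0 s E \is a fin_num by rewrite fin_num_measure.
have c0 : 0 <= fine (normal_prob 0 s E) by rewrite fine_ge0.
pose m1 := mrestr P (measurable_coord k mE).
pose m2 := mscale (NngNum c0) P.
have m2E C : m2 C = (normal_prob 0%R s E * P C)%E by rewrite /m2 /mscale/= fineK.
suff : m1 A = m2 A by rewrite m2E.
apply: (g_sigma_algebra_measure_unique cylinders measurable_cylinders (fun=> setT)) => //.
- move=> _; exists finset.set0, (fun=> setT); split => //; first by rewrite inE.
  by rewrite (_ : [set` _] = set0) ?bigcap_set0//; apply/seteqP; split => x //=; rewrite inE.
- by rewrite bigcup_const//; exists 0%N.
- move=> _ [J [F [kJ mF ->]]]; rewrite -[RHS]/(m2 _) m2E -[LHS]/(P (_ `&` _)).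
  have := @indepG (k |: J)%SET (fun j => if j == k then E else F j).
  rewrite big_setU1//= eqxx lawG// => H.
  rewrite [X in (_ * X)%E](@indepG J F mF).
  rewrite (eq_bigr (fun j => P (real_coord G j @^-1` F j))) in H; last first.
    by move=> j jJ; case: eqP => // jk; rewrite jk (negbTE kJ) in jJ.
  rewrite -H; last by move=> j; case: eqP.
  congr (P _); apply/seteqP; split => w /=.
    move=> [wF wE] j /=; rewrite !inE => /orP[/eqP->|jJ]; first by rewrite eqxx.
    by case: eqP => [->//|_]; exact: wF.
  move=> H'; split; last by have := H' k; rewrite /= !inE eqxx; exact.
  move=> j /= jJ; have := H' j; rewrite /= !inE jJ orbT => /(_ isT).
  by case: eqP => // jk; rewrite jk (negbTE kJ) in jJ.
- move=> _; rewrite /m1 /mrestr; apply: (le_lt_trans (probability_le1 _ _)); rewrite ?ltry//.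
  by apply: measurableI => //; exact: measurable_coord.
Qed.

(* Independence says that the pair (coordinate [k], sigma-algebra of the other
   coordinates) has a product law; [G] with its coordinate [k] overwritten by [x]
   is measurable for this product. *)
Lemma integral_resample (Phi : 'M[R[i]]_n -> \bar R) :
  (forall M, 0 <= Phi M)%E -> coord_measurable Phi ->
  (\int[P]_w Phi (G w) = \int[P]_w resample s k Phi (G w))%E.
Proof.
move=> Phi0 mPhi.
(* [T'] is [T] with only the sigma-algebra of the other coordinates; [iT] is the identity and [P']
   the restriction of [P]. *)
pose T' : measurableType _ := g_sigma_algebraType cylinders.
pose iT : T -> T' := id.
have miT : measurable_fun setT iT.
  move=> _ A mA; rewrite setTI.
  exact: (smallest_sub (@sigma_algebra_measurable _ T) measurable_cylinders mA).
pose iTm := isMeasurableFun.Build _ _ _ _ _ miT.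
pose iTp : {mfun T >-> T'} := HB.pack iT iTm.
pose P' : probability T' R := distribution P iTp.
pose N : probability (measurableTypeR R) R := normal_prob 0 s.
have mX : measurable_fun setT (real_coord G k : T -> measurableTypeR R) := mG k.
pose Z w : measurableTypeR R * T' := (real_coord G k w, iT w).
have mZ : measurable_fun setT Z by apply: measurable_fun_pair.
have law X : measurable X -> (N \x P')%E X = pushforward P Z X.
  apply: product_measure_unique => A B mA mB.
  rewrite /pushforward -(indep_cylinder mA mB); congr (P _).
  by apply/seteqP; split => w [].
pose h (p : measurableTypeR R * T') := Phi (set_coord k p.1 (G p.2)).
have mh : measurable_fun setT h.
  apply: mPhi => j; apply: measurable_set_coord => [|jk].
    exact: measurable_fst.
  apply: (measurableT_comp (f := real_coord G j : T' -> R)); last exact: measurable_snd.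
  move=> _ A mA; rewrite setTI; apply: sub_sigma_algebra.
  exists [set j]%SET, (fun=> A); split => //; first by rewrite inE eq_sym.
  by apply/seteqP; split => w /= H; [move=> j'; rewrite /= inE => /eqP ->|apply: H; rewrite /= inE].
transitivity (\int[pushforward P Z]_z h z)%E.
  rewrite ge0_integral_pushforward//; last by move=> *; exact: Phi0.
  by apply: eq_integral => w _; rewrite /h/= set_coord_real_coord.
rewrite (eq_measure_integral (N \x P')%E) => [|A mA _]; last exact/esym/law.
rewrite fubini_tonelli2//; last by move=> p; exact: Phi0.
have F0 y : (0 <= fubini_G N h y)%E by apply: integral_ge0 => x _; exact: Phi0.
have mF : measurable_fun setT (fubini_G N h).
  by apply: measurable_fun_fubini_tonelli_G => // p; exact: Phi0.
by rewrite ge0_integral_distribution.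
Qed.

End resampling.

(** * Integrating out a column *)

Definition resample_seq (R : realType) (s : R) n (ks : seq ('I_n * 'I_n * bool))
    (Phi : 'M[R[i]]_n -> \bar R) : 'M[R[i]]_n -> \bar R :=
  foldr (fun k => resample s k) Phi ks.

Lemma resample_seq_ge0 (R : realType) (s : R) n ks (Phi : 'M[R[i]]_n -> \bar R) M :
  (forall M, 0 <= Phi M)%E -> (0 <= resample_seq s ks Phi M)%E.
Proof.
move=> Phi0; elim: ks M => [|k ks IH] M; first exact: Phi0.
exact: resample_ge0.
Qed.

Lemma coord_measurable_resample_seq (R : realType) (s : R) n ks
    (Phi : 'M[R[i]]_n -> \bar R) :
  (forall M, 0 <= Phi M)%E -> coord_measurable Phi ->
  coord_measurable (resample_seq s ks Phi).
Proof.
move=> Phi0 mPhi; elim: ks => [//|k ks IH].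
by apply: coord_measurable_resample => // M; exact: resample_seq_ge0.
Qed.

Lemma integral_resample_seq (d : measure_display) (T : measurableType d) (R : realType)
    (P : probability T R) n (G : T -> 'M[R[i]]_n) (hG : ginibre P G) ks
    (Phi : 'M[R[i]]_n -> \bar R) :
  (forall M, 0 <= Phi M)%E -> coord_measurable Phi ->
  (\int[P]_w Phi (G w) =
   \int[P]_w resample_seq (Num.sqrt ((2 * n%:R)^-1)) ks Phi (G w))%E.
Proof.
move=> Phi0 mPhi; case: hG => mG lawG indepG; elim: ks => [//|k ks IH].
rewrite IH (integral_resample mG lawG indepG k)//.
  by move=> M; exact: resample_seq_ge0.
exact: coord_measurable_resample_seq.
Qed.

Lemma integral_probability_cst (d : measure_display) (T : measurableType d) (R : realType)
    (P : probability T R) (c : \bar R) : (\int[P]_x c = c)%E.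
Proof. by transitivity (c * P setT)%E; [exact: integral_cst|rewrite probability_setT mule1]. Qed.

(** For [a] nonzero, factoring out [a] turns the exponent into [c |u + z|^2], which splits into two
    real Gaussian integrals whose square roots multiply to one quotient. The case [a = 0] must be
    covered because a cofactor may vanish. The result has the shape of the integrand with [t]
    replaced by [t + 2 v |a|^2], hence the formula can be iterated. *)
Lemma integral_complex_gauss (R : realType) (v t C : R) (a b : R[i]) :
  0 < v -> 0 < t -> 0 <= C ->
  (\int[normal_prob 0%R (Num.sqrt v)]_x \int[normal_prob 0%R (Num.sqrt v)]_y
     (C * expR (- (sqn (b + a * (x +i* y)) / t)))%:E =
   (C * (t / (t + 2 * v * sqn a)) * expR (- (sqn b / (t + 2 * v * sqn a))))%:E)%E.
Proof.
move=> v0 t0 C0; have [->|a0] := eqVneq a 0.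
  rewrite sqn0 mulr0 addr0 divff ?gt_eqF// mulr1.
  under eq_integral do under eq_integral do rewrite mul0r addr0.
  by under eq_integral do rewrite (integral_probability_cst (normal_prob 0 _));
    rewrite (integral_probability_cst (normal_prob 0 _)).
have sa : 0 < sqn a by rewrite lt_neqAle eq_sym sqn_eq0 a0 sqn_ge0.
pose u := b / a; have au : a * u = b by rewrite mulrC divfK.
pose c := sqn a / t.
have c0 : 0 <= c by rewrite divr_ge0// ltW.
have q0 : 0 < 1 + 2 * c * v.
  by rewrite ltr_wpDr//; apply: mulr_ge0; [exact: mulr_ge0|exact: ltW].
have E x y : sqn (b + a * (x +i* y)) / t =
    c * (complex.Re u + x) ^+ 2 + c * (complex.Im u + y) ^+ 2.
  have -> : b + a * (x +i* y) = a * (u + (x +i* y)) by rewrite mulrDr au.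
  by rewrite sqnM /c /sqn !raddfD/=; field; rewrite gt_eqF.
have mg w : measurable_fun setT (fun y : measurableTypeR R => (expR (- (c * (w + y) ^+ 2)))%:E).
  apply/measurable_EFinP; apply: measurableT_comp => //; apply: measurableT_comp => //.
  by apply: measurable_funM => //; apply: measurable_funX; exact: measurable_funD.
pose K := (Num.sqrt (1 + 2 * c * v))^-1 * expR (- (c * complex.Im u ^+ 2 / (1 + 2 * c * v))).
have K0 : 0 <= K by rewrite mulr_ge0 ?invr_ge0 ?expR_ge0.
transitivity (\int[normal_prob 0%R (Num.sqrt v)]_x
    ((C * K)%:E * (expR (- (c * (complex.Re u + x) ^+ 2)))%:E))%E.
  apply: eq_integral => x _.
  transitivity (\int[normal_prob 0%R (Num.sqrt v)]_y
     ((C * expR (- (c * (complex.Re u + x) ^+ 2)))%:E *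
      (expR (- (c * (complex.Im u + y) ^+ 2)))%:E))%E.
    by apply: eq_integral => y _; rewrite E opprD expRD -EFinM mulrA.
  rewrite ge0_integralZl//; last by rewrite lee_fin mulr_ge0// expR_ge0.
  by rewrite integral_normal_gauss// -!EFinM -/K; congr _%:E; ring.
rewrite ge0_integralZl//; last by rewrite lee_fin mulr_ge0.
rewrite integral_normal_gauss// -EFinM; congr _%:E.
have sq : (Num.sqrt (1 + 2 * c * v))^-1 * (Num.sqrt (1 + 2 * c * v))^-1 = t / (t + 2 * v * sqn a).
  rewrite -expr2 exprVn sqr_sqrtr ?ltW// /c; field.
  rewrite (gt_eqF t0)/= gt_eqF// ltr_wpDr// !mulr_ge0// ltW//.
rewrite -sq /K.
set A := _^-1; rewrite (_ : sqn b = sqn a * sqn u); last first.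
  by rewrite -sqnM au.
have -> : expR (- (sqn a * sqn u / (t + 2 * v * sqn a))) =
  expR (- (c * complex.Im u ^+ 2 / (1 + 2 * c * v))) *
  expR (- (c * complex.Re u ^+ 2 / (1 + 2 * c * v))).
  rewrite -expRD /c /sqn; congr expR; field.
  rewrite -/(sqn a) (gt_eqF t0)/= !gt_eqF// ltr_wpDr// !mulr_ge0// ltW//.
by ring.
Qed.

(** The two real coordinates of an entry are adjacent, so that two successive resamplings form one
    complex Gaussian integral. *)
Definition column_coords n (j : 'I_n) (l : seq 'I_n) : seq ('I_n * 'I_n * bool) :=
  flatten [seq [:: (i, j, false); (i, j, true)] | i <- l].

(** Integrating out entry [i] removes [a i * M i j] from the linear form and adds [2 v |a i|^2] to
    the width; the quotients telescope. [M0] freezes the other columns, on which [a] and [b] are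
    allowed to depend. *)
Lemma resample_column (R : realType) (v t C : R) n (j : 'I_n) (a : 'I_n -> R[i]) (b : R[i])
    (M0 : 'M[R[i]]_n) (Phi : 'M[R[i]]_n -> \bar R) :
  0 < v -> 0 < t -> 0 <= C ->
  (forall M : 'M[R[i]]_n, (forall i k, k != j -> M i k = M0 i k) ->
     Phi M = (C * expR (- (sqn (b + \sum_i a i * M i j) / t)))%:E) ->
  forall l, uniq l -> forall M : 'M[R[i]]_n, (forall i k, k != j -> M i k = M0 i k) ->
  resample_seq (Num.sqrt v) (column_coords j l) Phi M =
  (C * (t / (t + 2 * v * \sum_(i in l) sqn (a i))) *
   expR (- (sqn (b + \sum_(i | i \notin l) a i * M i j) /
            (t + 2 * v * \sum_(i in l) sqn (a i)))))%:E.
Proof.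
move=> v0 t0 C0 PhiE; elim=> [|i l IH] /=.
  move=> _ M MM0; rewrite PhiE// big_pred0_eq mulr0 addr0 divff ?gt_eqF// mulr1.
  by congr (_ * expR (- (sqn (_ + _) / _)))%:E; apply: eq_bigl => i.
case/andP=> il ul M MM0; rewrite /resample.
set S := \sum_(i in l) _ in IH *.
have S0 : 0 <= S by apply: sumr_ge0 => *; exact: sqn_ge0.
have tS : 0 < t + 2 * v * S by rewrite ltr_wpDr// !mulr_ge0// ltW.
pose M' x y := set_coord (i, j, true) y (set_coord (i, j, false) x M).
have M'E x y : M' x y i j = x +i* y by rewrite !mxE/= !eqxx.
have M'N x y p q : (p, q) != (i, j) -> M' x y p q = M p q.
  by move=> pq; rewrite !mxE/= (negbTE pq).
under eq_integral => x _.
  under eq_integral => y _.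
    rewrite -/(M' x y) IH//; last first.
      by move=> p q qj; rewrite M'N ?MM0// xpair_eqE (negbTE qj) andbF.
    rewrite (bigD1 i)//= M'E addrCA addrC.
    rewrite (eq_bigr (fun p => a p * M p j)); last first.
      by move=> p /andP[_ pi]; rewrite M'N// xpair_eqE (negbTE pi).
    over.
  over.
rewrite integral_complex_gauss//; last by rewrite mulr_ge0// divr_ge0// ltW.
have SE : \sum_(p in i :: l) sqn (a p) = sqn (a i) + S.
  rewrite (bigD1 i) ?mem_head//=; congr (_ + _); apply: eq_bigl => p.
  rewrite inE; have [->|pi] := eqVneq p i; first by rewrite (negbTE il).
  by rewrite andbT.
rewrite SE.
have -> : t + 2 * v * S + 2 * v * sqn (a i) = t + 2 * v * (sqn (a i) + S) by ring.
congr (_ * expR (- (sqn (_ + _) / _)))%:E.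
  by rewrite -mulrA; congr (_ * _); rewrite mulrA divfK// gt_eqF.
by apply: eq_bigl => p; rewrite inE negb_or andbC.
Qed.

(* [exp (- 1 / (s^2 X))], where [X] is the squared norm of row [j] of [N^-1]: by
   Cramer's rule that row is the vector of cofactors divided by the determinant.
   The guard discards [0 / 0], for which the exponential would be [1]. *)
Definition gauss_test (R : realType) (s : R) n (j : 'I_n) (N : 'M[R[i]]_n) : R :=
  let S := \sum_i sqn (cofactor N i j) in
  if S == 0 then 0 else expR (- (sqn (\det N) / (s ^+ 2 * S))).

Lemma gauss_test_ge0 (R : realType) (s : R) n (j : 'I_n) (N : 'M[R[i]]_n) :
  0 <= gauss_test s j N.
Proof. by rewrite /gauss_test; case: ifP => // _; exact: expR_ge0. Qed.

Lemma measurable_gauss_test (d : measure_display) (S : measurableType d) (R : realType)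
    (s : R) n (j : 'I_n) (N : S -> 'M[R[i]]_n) :
  (forall i k, cmeasurable (fun w => N w i k)) ->
  measurable_fun setT (fun w => gauss_test s j (N w)).
Proof.
move=> mN; pose Sf w := \sum_i sqn (cofactor (N w) i j).
have mS : measurable_fun setT Sf.
  by apply: measurable_sum => i; apply: measurable_sqn; exact: cmeasurable_cofactor.
apply: measurable_fun_ifT => //.
  by apply: measurable_fun_eqr.
apply: measurableT_comp => //; apply: measurableT_comp => //.
apply: measurable_funM; first by apply: measurable_sqn; exact: cmeasurable_det.
have Sf0 w : 0 <= s ^+ 2 * Sf w.
  by rewrite mulr_ge0 ?sqr_ge0// sumr_ge0// => *; exact: sqn_ge0.
(* On nonnegative reals inversion is the power [-1], with the same value 0 at 0, so measurability
   holds across the zeros of [Sf] as well. *)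
rewrite (_ : (fun _ => _) = fun w => (s ^+ 2 * Sf w) `^ (-1)); last first.
  by apply/funext => w; rewrite powR_inv1.
have m2 : measurable_fun setT (fun w => s ^+ 2 * Sf w) by exact: measurable_funM.
exact: (measurableT_comp (measurable_powR (-1)) m2).
Qed.

Lemma eq_cofactor_col (R : comNzRingType) n (N N' : 'M[R]_n) i j :
  (forall i k, k != j -> N i k = N' i k) -> cofactor N i j = cofactor N' i j.
Proof.
move=> NN'; rewrite /cofactor; congr (_ * \det _); apply/matrixP => a b.
by rewrite !mxE NN'// eq_sym neq_lift.
Qed.

(** The bound already holds after averaging over column [j] alone, for any value of the others. With
    [t = s^2 S] and [2 v = 1 / n], the quotient [t / (t + 2 v delta^2 S)] equals
    [s^2 / (s^2 + delta^2 / n)]; the remaining exponential, the only place where [A] and [z] appear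
    explicitly, is at most 1. *)
Lemma integral_gauss_test_le (d : measure_display) (T : measurableType d) (R : realType)
    (P : probability T R) n (hn : (0 < n)%N) (A : 'M[R[i]]_n) (delta s : R)
    (G : T -> 'M[R[i]]_n) (z : R[i]) (j : 'I_n) :
  ginibre P G -> 0 < delta -> 0 < s ->
  (\int[P]_w (gauss_test s j (A + delta%:C *: G w - z%:M))%:E <=
   (s ^+ 2 * (n%:R / delta ^+ 2))%:E)%E.
Proof.
move=> hG d0 s0.
pose F (M : 'M[R[i]]_n) := A + delta%:C *: M - z%:M.
pose Phi M := (gauss_test s j (F M))%:E.
have FE M i k : F M i k = A i k - z%:M i k + delta%:C * M i k.
  by rewrite !mxE addrAC.
have Phi0 M : (0 <= Phi M)%E by rewrite lee_fin gauss_test_ge0.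
have mPhi : coord_measurable Phi.
  move=> d' S M mM; apply/measurable_EFinP; apply: measurable_gauss_test => i k.
  under eq_fun do rewrite FE.
  apply: cmeasurableD; first exact: cmeasurable_cst.
  by apply: cmeasurableM; [exact: cmeasurable_cst|exact: cmeasurable_entry].
set v := (2 * n%:R)^-1 : R.
have n0 : 0 < n%:R :> R by rewrite ltr0n.
have v0 : 0 < v by rewrite invr_gt0 mulr_gt0.
have bound M : (resample_seq (Num.sqrt v) (column_coords j (enum 'I_n)) Phi M <=
    (s ^+ 2 * (n%:R / delta ^+ 2))%:E)%E.
  pose c i := cofactor (F M) i j; pose S := \sum_i sqn (c i).
  have S0 : 0 <= S by apply: sumr_ge0 => *; exact: sqn_ge0.
  pose b := \sum_i (A i j - z%:M i j) * c i.
  (* When all cofactors vanish, [C = 0] reproduces the guard of [gauss_test], and the value 1 keeps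
     [t] positive. *)
  pose t := if S == 0 then 1 else s ^+ 2 * S.
  pose C : R := if S == 0 then 0 else 1.
  have t0 : 0 < t.
    by rewrite /t; case: eqVneq => // SN; rewrite mulr_gt0 ?exprn_gt0// lt_neqAle eq_sym SN.
  have C0 : 0 <= C by rewrite /C; case: ifP.
  have cE (M' : 'M[R[i]]_n) : (forall i k, k != j -> M' i k = M i k) ->
      forall i, cofactor (F M') i j = c i.
    by move=> MM' i; apply: eq_cofactor_col => p q qj; rewrite !FE MM'.
  rewrite (@resample_column R v t C n j (fun i => delta%:C * c i) b M)//; first last.
  - exact: enum_uniq.
  - move=> M' MM'; rewrite /Phi /gauss_test (eq_bigr (fun i => sqn (c i))); last first.
      by move=> i _; rewrite cE.
    rewrite -/S /t /C; case: ifP => _; first by rewrite mul0r.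
    have -> : \det (F M') = b + \sum_i delta%:C * c i * M' i j.
      rewrite (expand_det_col _ j) /b -big_split; apply: eq_bigr => i _ /=.
      by rewrite cE// FE mulrDl (mulrAC delta%:C).
    by rewrite mul1r.
  have SE : \sum_(i in enum 'I_n) sqn (delta%:C * c i) = delta ^+ 2 * S.
    rewrite mulr_sumr; apply: eq_big => [i|i _]; first by rewrite mem_enum.
    by rewrite sqnM {1}/sqn/= expr0n addr0.
  rewrite SE lee_fin; set q := t + _.
  have q0 : 0 < q by rewrite /q ltr_wpDr// !mulr_ge0// ?sqr_ge0// ltW.
  apply: (@le_trans _ _ (C * (t / q))).
    rewrite ler_piMr//.
      by apply: mulr_ge0 => //; apply: divr_ge0; exact: ltW.
    by rewrite -[leRHS]expR0 ler_expR oppr_le0 divr_ge0 ?sqn_ge0// ltW.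
  rewrite /C; have [S00|SN] := eqVneq S 0.
    by rewrite mul0r mulr_ge0 ?sqr_ge0// divr_ge0 ?sqr_ge0// ltW.
  have Sp : 0 < S by rewrite lt_neqAle eq_sym SN.
  rewrite mul1r ler_pdivrMr// /q /t (negbTE SN) /v.
  rewrite -subr_ge0 (_ : _ - _ = s ^+ 2 * n%:R / delta ^+ 2 * (s ^+ 2 * S)).
    by rewrite !mulr_ge0// ?invr_ge0 ?sqr_ge0// ltW.
  by field; rewrite !gt_eqF.
rewrite (integral_resample_seq hG (column_coords j (enum 'I_n)) Phi0 mPhi) -/v.
apply: (@le_trans _ _ (\int[P]_w (s ^+ 2 * (n%:R / delta ^+ 2))%:E)%E).
  apply: ge0_le_integral => //.
  - by move=> w _; exact: resample_seq_ge0.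
  - exact: (coord_measurable_resample_seq _ _ Phi0 mPhi (ginibre_measurable hG)).
by rewrite (integral_probability_cst P).
Qed.

(** * Matrices with distinct eigenvalues *)

(* With [p] the characteristic polynomial of [M], this is the determinant of [p'(M)],
   the product of the [p'(lambda_i)], i.e. the discriminant of [p] up to sign. *)
Definition eig_disc (K : comNzRingType) n (M : 'M[K]_n.+1) : K :=
  \det (horner_mx M (char_poly M)^`()).

Lemma map_eig_disc (K L : comNzRingType) (f : {rmorphism K -> L}) n (M : 'M[K]_n.+1) :
  eig_disc (map_mx f M) = f (eig_disc M).
Proof. by rewrite /eig_disc -map_char_poly deriv_map -map_horner_mx det_map_mx. Qed.

(** A repeated root makes [X - lam i] divide the derivative, so the singular matrix [M - lam i] is a
    factor of the matrix whose determinant is taken. *)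
Lemma eig_disc_injective (K : fieldType) n (M : 'M[K]_n.+1) (lam : 'I_n.+1 -> K) :
  char_poly M = \prod_i ('X - (lam i)%:P) -> eig_disc M != 0 -> injective lam.
Proof.
move=> pM disc0 i j lij; apply/eqP/negPn/negP => ij; case/negP: disc0.
pose q := \prod_(k | (k != i) && (k != j)) ('X - (lam k)%:P).
have pE : char_poly M = ('X - (lam i)%:P) * (('X - (lam i)%:P) * q).
  by rewrite pM (bigD1 i)//= (bigD1 j) 1?eq_sym//= -lij.
rewrite /eig_disc pE derivM derivXsubC mul1r.
set r := _ * q; rewrite -[X in X + _]/(_ * q) -mulrDr rmorphM/= det_mulmx.
rewrite rmorphB/= horner_mx_X horner_mx_C.
have : eigenvalue M (lam i).
  by rewrite eigenvalue_root_char pE rootM root_XsubC eqxx.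
rewrite /eigenvalue /eigenspace kermx_eq0 row_free_unit unitmxE unitfE negbK => /eqP ->.
by rewrite mul0r.
Qed.

(** Provides a matrix at which the discriminant, a polynomial in the entries, is nonzero. *)
Lemma eig_disc_diag (K : fieldType) n (D : 'rV[K]_n.+1) :
  injective (D 0) -> eig_disc (diag_mx D) != 0.
Proof.
move=> Di; have pE : char_poly (diag_mx D) = \prod_i ('X - (D 0 i)%:P).
  rewrite char_poly_trig ?diag_mx_is_trig//; apply: eq_bigr => i _.
  by rewrite mxE eqxx.
rewrite /eig_disc horner_mx_diag det_diag; apply/prodf_neq0 => i _.
rewrite mxE pE (bigD1 i)//= derivM derivXsubC mul1r hornerD hornerM hornerXsubC subrr.
rewrite mul0r addr0 horner_prod; apply/prodf_neq0 => j ji.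
by rewrite hornerXsubC subr_eq0; apply: contra_neq ji => /Di.
Qed.

(** Left eigenvectors are stacked as the rows of [W]. They are independent because the polynomial in
    [M] that vanishes at every eigenvalue but the [k]-th isolates the [k]-th coefficient of a
    vanishing combination. *)
Lemma distinct_diagonalization_eigenvalues (R : realType) n (M : 'M[R[i]]_n.+1)
    (lam : 'I_n.+1 -> R[i]) :
  eigenvalues M lam -> injective lam ->
  exists V, distinct_diagonalization M V (\row_i lam i).
Proof.
move=> pM lami.
have ev i : eigenvalue M (lam i).
  by rewrite eigenvalue_root_char pM (bigD1 i)//= rootM root_XsubC eqxx.
have /choice[u uP] : forall i, exists u : 'rV_n.+1, u *m M = lam i *: u /\ u != 0.
  by move=> i; have /eigenvalueP[u ? ?] := ev i; exists u.
have uq i q : u i *m horner_mx M q = q.[lam i] *: u i.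
  elim/poly_ind: q => [|q c IH]; first by rewrite rmorph0 mulmx0 horner0 scale0r.
  rewrite rmorphD rmorphM/= horner_mx_X horner_mx_C mulmxDr mulmxA IH -scalemxAl (uP i).1.
  by rewrite mul_mx_scalar !hornerE scalerDl scalerA.
pose W := \matrix_i u i.
have Wu : W \in unitmx.
  rewrite -row_free_unit -kermx_eq0; apply/rowV0P => x /sub_kermxP xW.
  apply/rowP => k; rewrite mxE.
  pose q := \prod_(l | l != k) ('X - (lam l)%:P).
  have : x *m W *m horner_mx M q = x 0 k * q.[lam k] *: u k.
    rewrite (mulmx_sum_row x W) mulmx_suml (bigD1 k)//= rowK -scalemxAl uq scalerA big1 ?addr0//.
    move=> l lk; rewrite rowK -scalemxAl uq /q (bigD1 l)//= hornerM hornerXsubC subrr.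
    by rewrite mul0r scale0r scaler0.
  rewrite xW mul0mx => /esym/eqP; rewrite scaler_eq0 (negbTE (uP k).2) orbF mulf_eq0.
  case/orP => [/eqP//|]; rewrite horner_prod => /eqP/eqP; rewrite prodf_seq_eq0.
  case/hasP => l _ /andP[lk]; rewrite hornerXsubC subr_eq0 => /eqP/lami kl.
  by rewrite kl eqxx in lk.
have WM : W *m M = diag_mx (\row_i lam i) *m W.
  apply/row_matrixP => k; rewrite row_mul rowK (uP k).1 row_mul row_diag_mx -scalemxAl.
  by rewrite mxE -rowE rowK.
exists (invmx W); split; first by rewrite unitmx_inv.
  by move=> a b; rewrite !mxE => /lami.
by rewrite invmxK -mulmxA -WM mulKmx.
Qed.

Section poly_measurability.
Context (d : measure_display) (S : measurableType d) (R : realType).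

Let pmeasurable (p : S -> {poly R[i]}) := forall k, cmeasurable (fun s => (p s)`_k).

Let pmeasurable_cst (p : {poly R[i]}) : pmeasurable (fun _ : S => p).
Proof. by move=> k; exact: cmeasurable_cst. Qed.

Let pmeasurableM (p q : S -> {poly R[i]}) : pmeasurable p -> pmeasurable q ->
  pmeasurable (fun s => p s * q s).
Proof.
move=> mp mq k; under eq_fun do rewrite coefM.
by apply: cmeasurable_sum => l _; exact: cmeasurableM.
Qed.

Let pmeasurable_prod (I : Type) (r : seq I) (p : I -> S -> {poly R[i]}) :
  (forall i, pmeasurable (p i)) -> pmeasurable (fun s => \prod_(i <- r) p i s).
Proof.
move=> mp; elim: r => [|i r IH].
  by under eq_fun do rewrite big_nil; exact: pmeasurable_cst.
by under eq_fun do rewrite big_cons; exact: pmeasurableM.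
Qed.

Lemma cmeasurable_char_poly n (M : S -> 'M[R[i]]_n) k :
  (forall i j, cmeasurable (fun s => M s i j)) ->
  cmeasurable (fun s => (char_poly (M s))`_k).
Proof.
move=> mM; under eq_fun do rewrite /char_poly /determinant coef_sum.
apply: cmeasurable_sum => s _; move: k; apply: pmeasurableM.
  exact: pmeasurable_cst.
apply: pmeasurable_prod => i k; rewrite /char_poly_mx.
under eq_fun do rewrite !mxE coefB coefC.
apply: cmeasurableD; first exact: cmeasurable_cst.
by apply: cmeasurableN; case: (k == 0)%N; [exact: mM|exact: cmeasurable_cst].
Qed.

(** A bound [m] common to all sample points fixes the number of terms, so that measurability can be
    checked term by term. *)
Lemma horner_mx_coef_wide (K : comNzRingType) n (M : 'M[K]_n.+1) (q : {poly K}) m :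
  (size q <= m)%N -> horner_mx M q = \sum_(k < m) q`_k *: M ^+ k.
Proof.
move=> qm; have -> : q = \sum_(k < m) q`_k *: 'X^k.
  rewrite -(poly_def m (nth 0 q)); apply/polyP => k; rewrite coef_poly.
  by case: ltnP => // mk; rewrite nth_default// (leq_trans qm).
rewrite linear_sum; apply: eq_bigr => k _ /=.
rewrite linearZ/= rmorphXn/= horner_mx_X -(poly_def m (nth 0 q)) coef_poly ltn_ord.
by [].
Qed.

Lemma cmeasurable_eig_disc n (M : S -> 'M[R[i]]_n.+1) :
  (forall i j, cmeasurable (fun s => M s i j)) -> cmeasurable (fun s => eig_disc (M s)).
Proof.
move=> mM; apply: cmeasurable_det => i j.
have sz s : (size (char_poly (M s))^`() <= n.+1)%N.
  by have := lt_size_deriv (monic_neq0 (char_poly_monic (M s))); rewrite size_char_poly ltnS.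
under eq_fun => s do rewrite (horner_mx_coef_wide _ (sz s)) summxE.
apply: cmeasurable_sum => k _; under eq_fun do rewrite mxE coef_deriv -mulr_natr.
apply: cmeasurableM.
  by apply: cmeasurableM; [exact: cmeasurable_char_poly|exact: cmeasurable_cst].
elim: (k : nat) i j => [|l IH] i j.
  by under eq_fun do rewrite expr0; exact: cmeasurable_cst.
under eq_fun do rewrite exprS mxE.
by apply: cmeasurable_sum => p _; exact: cmeasurableM.
Qed.

End poly_measurability.

Lemma normal_prob_finite0 (R : realType) (m s : R) (A : set R) :
  finite_set A -> normal_prob m s A = 0%E.
Proof.
move=> fA; have A0 : lebesgue_measure A = 0%E.
  exact/countable_lebesgue_measure0/finite_set_countable.
have mA : measurable A by apply: countable_measurable => //; exact: finite_set_countable.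
have := @normal_prob_dominates R m s.
by move=> /null_content_dominatesP; apply.
Qed.

(** This is [set_coord] with the real value replaced by the indeterminate: along one coordinate the
    discriminant becomes a polynomial in one variable. *)
Definition poly_set_coord (R : realType) n (k : 'I_n * 'I_n * bool) (M : 'M[R[i]]_n) :
    'M[{poly R[i]}]_n :=
  \matrix_(i, j) if (i, j) == k.1 then
      if k.2 then (complex.Re (M i j))%:C%:P + 'i%:P * 'X
      else 'X + ('i * (complex.Im (M i j))%:C)%:P
    else (M i j)%:P.

Lemma horner_poly_set_coord (R : realType) n (k : 'I_n * 'I_n * bool) (M : 'M[R[i]]_n) (x : R) :
  map_mx (horner_eval x%:C) (poly_set_coord k M) = set_coord k x M.
Proof.
apply/matrixP => i j; rewrite !mxE /horner_eval; case: ifP => _; last by rewrite hornerC.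
case: k.2; rewrite !hornerE; apply/eqP; rewrite eq_complex/=;
  by rewrite ?mul0r ?mul1r ?mulr0 ?subr0 ?addr0 ?add0r ?eqxx.
Qed.

(** The polynomial [q] is nonzero because its value at the coordinate [k] of [M] itself is
    [eig_disc (A + c *: M)]. Its finitely many complex roots include all the real zeros. *)
Lemma finite_eig_disc_set_coord (R : realType) n (A : 'M[R[i]]_n.+1) (c : R[i])
    (k : 'I_n.+1 * 'I_n.+1 * bool) (M : 'M[R[i]]_n.+1) :
  eig_disc (A + c *: M) != 0 ->
  finite_set [set x : R | eig_disc (A + c *: set_coord k x M) = 0].
Proof.
move=> disc0; pose q := eig_disc (map_mx polyC A + c%:P *: poly_set_coord k M).
have qE (x : R) : q.[x%:C] = eig_disc (A + c *: set_coord k x M).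
  have eA : map_mx (horner_eval x%:C) (map_mx polyC A) = A.
    by apply/matrixP => i j; rewrite !mxE /horner_eval hornerC.
  have ec : horner_eval x%:C c%:P = c by rewrite /horner_eval hornerC.
  rewrite -[LHS]/(horner_eval x%:C q) -map_eig_disc map_mxD map_mxZ horner_poly_set_coord.
  by rewrite eA [X in X *: _]ec.
have q0 : q != 0.
  apply: contraNneq disc0 => q0.
  by have := qE (real_coord id k M); rewrite q0 horner0 set_coord_real_coord => <-.
have [r qr] := closed_field_poly_normal q.
apply: (@sub_finite_set _ _ [set` [seq complex.Re z | z <- r]]); last exact: finite_seq.
move=> x /= /eqP; rewrite -qE qr hornerZ mulf_eq0 lead_coef_eq0 (negbTE q0)/=.
rewrite -/(root _ _) root_prod_XsubC => xr.
by apply/mapP; exists x%:C.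
Qed.

Lemma matrix_real_coordP (R : realType) n (M N : 'M[R[i]]_n) :
  (forall k, real_coord id k M = real_coord id k N) -> M = N.
Proof.
move=> MN; apply/matrixP => i j.
have := MN (i, j, true); have := MN (i, j, false); rewrite /real_coord/=.
by case: (M i j) (N i j) => [a b] [a' b'] /= -> ->.
Qed.

Definition disc_zero (R : realType) n (A : 'M[R[i]]_n.+1) (c : R[i])
  (M : 'M[R[i]]_n.+1) : \bar R := (eig_disc (A + c *: M) == 0)%:R%:E.

Lemma disc_zero_ge0 (R : realType) n (A : 'M[R[i]]_n.+1) c M : (0 <= disc_zero A c M)%E.
Proof. by rewrite lee_fin ler0n. Qed.

Lemma measurable_disc_zero_set (d : measure_display) (S : measurableType d) (R : realType)
    n (A : 'M[R[i]]_n.+1) (c : R[i]) (M : S -> 'M[R[i]]_n.+1) :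
  (forall k, measurable_fun setT (real_coord M k)) ->
  measurable [set w | eig_disc (A + c *: M w) = 0].
Proof.
move=> mM; have md : cmeasurable (fun w => eig_disc (A + c *: M w)).
  apply: cmeasurable_eig_disc => i j; under eq_fun do rewrite !mxE.
  apply: cmeasurableD; first exact: cmeasurable_cst.
  by apply: cmeasurableM; [exact: cmeasurable_cst|exact: cmeasurable_entry].
have := measurable_sqn md => /(_ measurableT [set 0] (measurable_set1 _)).
rewrite setTI; congr (measurable _); apply/seteqP; split => w /= /eqP.
  by rewrite sqn_eq0 => /eqP.
by rewrite -sqn_eq0 => /eqP.
Qed.

Lemma coord_measurable_disc_zero (R : realType) n (A : 'M[R[i]]_n.+1) c :
  coord_measurable (disc_zero A c).
Proof.
move=> d S M mM; apply/measurable_EFinP.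
rewrite (_ : (fun _ => _) = \1_[set w | eig_disc (A + c *: M w) = 0]).
  by apply: measurable_indic; exact: measurable_disc_zero_set.
apply/funext => w; rewrite indicE; congr ((nat_of_bool _)%:R).
by apply/idP/idP => [/eqP h|/set_mem h]; [exact: mem_set|exact/eqP].
Qed.

(* As a function of one coordinate the discriminant is a polynomial; if it is nonzero
   somewhere then its zeros are finitely many and negligible. *)
Lemma resample_disc_zero (R : realType) (s : R) n (A : 'M[R[i]]_n.+1) (c : R[i]) ks
    (M M1 : 'M[R[i]]_n.+1) :
  (forall k, k \notin ks -> real_coord id k M1 = real_coord id k M) ->
  eig_disc (A + c *: M1) != 0 -> resample_seq s ks (disc_zero A c) M = 0%E.
Proof.
elim: ks M M1 => [|k ks IH] M M1 MM1 disc0 /=.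
  by rewrite /disc_zero (@matrix_real_coordP _ _ M M1) ?(negbTE disc0)// => k; rewrite MM1.
pose Psi := resample_seq s ks (disc_zero A c).
have Psi0 M' : (0 <= Psi M')%E by apply: resample_seq_ge0 => ?; exact: disc_zero_ge0.
rewrite /resample -/Psi.
pose Z := [set x : R | eig_disc (A + c *: set_coord k x M1) = 0].
have fZ : finite_set Z := finite_eig_disc_set_coord k disc0.
have mPsi : measurable_fun setT (fun x : measurableTypeR R => Psi (set_coord k x M)).
  apply: coord_measurable_resample_seq => [M'||j].
  - exact: disc_zero_ge0.
  - exact: coord_measurable_disc_zero.
  - apply: measurable_set_coord => // _; exact: measurable_cst.
have NZ : normal_prob 0 s Z = 0%E by exact: normal_prob_finite0.
have mZ : measurable (Z : set (measurableTypeR R)).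
  by apply: countable_measurable => //; exact: finite_set_countable.
rewrite (ge0_ae_eq_integral (g := fun=> 0%E)) ?integral0//.
exists Z; split => // x /=; apply: contra_notP => /eqP ZN _.
(* For [x] outside [Z] the new witness is [M1] with the same value [x] written at [k]; its
   discriminant is still nonzero, and it agrees with [set_coord k x M] outside [ks]. *)
apply: (IH _ (set_coord k x M1)) => // j jks.
have := real_coord_set k j (fun=> x) (fun=> M1) tt.
have := real_coord_set k j (fun=> x) (fun=> M) tt.
rewrite /real_coord => -> ->; case: eqVneq => // jk.
by apply: MM1; rewrite inE negb_or jk.
Qed.

(** Once every coordinate is resampled, no agreement between the witness and [G w] is required. The
    witness is the matrix that makes [A + delta M] diagonal with entries [0, 1, ..., n]. *)
Lemma ginibre_eig_disc_neq0 (d : measure_display) (T : measurableType d) (R : realType)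
    (P : probability T R) n (A : 'M[R[i]]_n.+1) (delta : R) (G : T -> 'M[R[i]]_n.+1) :
  ginibre P G -> 0 < delta ->
  P [set w | eig_disc (A + delta%:C *: G w) = 0] = 0%E.
Proof.
move=> hG d0; set N := [set w | _].
have mN : measurable N := measurable_disc_zero_set _ _ (ginibre_measurable hG).
transitivity (\int[P]_w disc_zero A delta%:C (G w))%E.
  rewrite -[X in P X](setIT N) -integral_indic//; apply: eq_integral => w _.
  rewrite /disc_zero indicE; congr ((nat_of_bool _)%:R%:E).
  by apply/idP/idP => [/set_mem h|/eqP h]; [exact/eqP|exact: mem_set].
rewrite (integral_resample_seq hG (enum [set: 'I_n.+1 * 'I_n.+1 * bool]%SET)); last 2 first.
- by move=> M; exact: disc_zero_ge0.
- exact: coord_measurable_disc_zero.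
apply: integral0_eq => w _.
have d0C : delta%:C != 0 by rewrite eq_complex/= gt_eqF.
pose D : 'rV[R[i]]_n.+1 := \row_k k%:R.
apply: (@resample_disc_zero _ _ _ _ _ _ _ (delta%:C^-1 *: (diag_mx D - A))).
  by move=> k; rewrite mem_enum inE.
rewrite scalerA divff// scale1r addrC subrK; apply: eig_disc_diag => a b.
by rewrite !mxE => /eqP; rewrite eqr_nat => /eqP/val_inj.
Qed.

(** * Concentration of narrow Gaussians *)

Section product_gauss.
Context (R : realType).
Notation mu := (@lebesgue_measure R).

Lemma integral_product_fun (f g : measurableTypeR R -> \bar R) :
  measurable_fun setT f -> measurable_fun setT g ->
  (forall x, 0 <= f x)%E -> (forall x, 0 <= g x)%E ->
  (\int[mu \x mu]_p (f p.1 * g p.2) = (\int[mu]_x f x) * (\int[mu]_x g x))%E.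
Proof.
move=> mf mg f0 g0; rewrite fubini_tonelli1//=; last 2 first.
- apply: emeasurable_funM; first exact: (measurableT_comp mf measurable_fst).
  exact: (measurableT_comp mg measurable_snd).
- by move=> p; exact: mule_ge0.
transitivity (\int[mu]_x (f x * \int[mu]_y g y))%E.
  by apply: eq_integral => x _; rewrite /fubini_F/= ge0_integralZl.
by rewrite ge0_integralZr//; exact: integral_ge0.
Qed.

(** The normalising peak is left out because these functions are compared with [gauss_test], an
    exponential without prefactor. *)
Definition gauss_on (a sigma : R) (A : set R) (x : R) : R := normal_fun a sigma x * \1_A x.

Lemma gauss_on_ge0 a sigma A x : 0 <= gauss_on a sigma A x.
Proof. by rewrite mulr_ge0// normal_fun_ge0. Qed.

Lemma measurable_gauss_on a sigma (A : set (measurableTypeR R)) : measurable A ->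
  measurable_fun setT (gauss_on a sigma A : measurableTypeR R -> R).
Proof.
move=> mA; apply: measurable_funM; first exact: measurable_normal_fun.
exact: measurable_indic.
Qed.

Lemma integral_gauss_on a sigma (A : set (measurableTypeR R)) : sigma != 0 -> measurable A ->
  (\int[mu]_x (gauss_on a sigma A x)%:E =
   ((normal_peak sigma)^-1)%:E * normal_prob a sigma A)%E.
Proof.
move=> s0 mA; rewrite /normal_prob -ge0_integralZl//; first last.
- by rewrite lee_fin invr_ge0 normal_peak_ge0.
- by move=> x _; rewrite lee_fin normal_pdf_ge0.
- by apply/measurable_EFinP; apply: measurable_funTS; exact: measurable_normal_pdf.
rewrite [RHS]integral_mkcond; apply: eq_integral => x _.
rewrite patchE /gauss_on indicE; case: ifPn => xA; last by rewrite mulr0.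
by rewrite mulr1 -EFinM normal_pdfE// mulKf// gt_eqF// normal_peak_gt0.
Qed.

Definition sym_itv (a r : R) : set (measurableTypeR R) := [set x | `|x - a| < r].

Lemma sym_itvE (a r : R) : sym_itv a r = `]a - r, a + r[%classic.
Proof. by apply/seteqP; split => x; rewrite /sym_itv/= in_itv/= ltr_distl. Qed.

Lemma measurable_sym_itv (a r : R) : measurable (sym_itv a r).
Proof. by rewrite sym_itvE; exact: measurable_itv. Qed.

(** Half of the exponent is kept as a Gaussian of standard deviation [sqrt 2 * sigma], of mass at
    most 1 on the tail. The other half is [exp (- u)], at most [1 / u], hence at most
    [4 sigma^2 / r^2]. The ratio of the peaks is [sqrt 2], rounded up to 2, whence the constant
    8. *)
Lemma normal_prob_tail (a sigma r : R) : 0 < sigma -> 0 < r ->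
  (normal_prob a sigma (~` sym_itv a r) <= (8 * sigma ^+ 2 / r ^+ 2)%:E)%E.
Proof.
move=> s0 r0; have s20 : Num.sqrt 2 * sigma != 0.
  by rewrite mulf_neq0 ?gt_eqF// sqrtr_gt0.
pose c := 8 * sigma ^+ 2 / r ^+ 2.
have c0 : 0 <= c.
  by apply: divr_ge0; [apply: mulr_ge0 => //|]; exact: sqr_ge0.
have mD : measurable (~` sym_itv a r).
  by apply: measurableC; exact: measurable_sym_itv.
rewrite /normal_prob.
apply: (@le_trans _ _ (\int[mu]_(x in ~` sym_itv a r)
    (c%:E * (normal_pdf a (Num.sqrt 2 * sigma) x)%:E)))%E.
  apply: ge0_le_integral => //.
  - by move=> x _; rewrite lee_fin normal_pdf_ge0.
  - by apply/measurable_EFinP; apply: measurable_funTS; exact: measurable_normal_pdf.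
  - apply/measurable_EFinP; apply: measurable_funTS; apply: measurable_funM => //.
    exact: measurable_normal_pdf.
  move=> x /= xr; rewrite -EFinM lee_fin (normal_pdfE a s20) (normal_pdfE a (lt0r_neq0 s0)).
  have rx : r ^+ 2 <= (x - a) ^+ 2.
    rewrite -[leRHS]real_normK ?num_real// ler_pXn2r ?nnegrE ?(ltW r0)//.
    by rewrite leNgt; apply/negP.
  have -> : normal_peak sigma = Num.sqrt 2 * normal_peak (Num.sqrt 2 * sigma).
    rewrite /normal_peak.
    have -> : (Num.sqrt 2 * sigma) ^+ 2 * pi *+ 2 = 2 * (sigma ^+ 2 * pi *+ 2) :> R.
      by rewrite exprMn sqr_sqrtr// -mulrA mulrnAr.
    rewrite (sqrtrM (sigma ^+ 2 * pi *+ 2) (ler0n R 2)) invfM mulrA divff ?mul1r//.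
  rewrite (mulrC (Num.sqrt 2)) -mulrA [leRHS]mulrCA.
  apply: ler_wpM2l; first exact: normal_peak_ge0.
  rewrite /normal_fun exprMn sqr_sqrtr//.
  set u := (x - a) ^+ 2 / (4 * sigma ^+ 2).
  have -> : - (x - a) ^+ 2 / (sigma ^+ 2 *+ 2) = - u - u.
    by rewrite /u; field; rewrite gt_eqF.
  have -> : - (x - a) ^+ 2 / ((2 * sigma ^+ 2) *+ 2) = - u.
    by rewrite /u; field; rewrite gt_eqF.
  rewrite expRD mulrA ler_wpM2r ?expR_ge0//.
  have r20 : 0 < r ^+ 2 := exprn_gt0 2 r0.
  have xa0 : 0 < (x - a) ^+ 2 := lt_le_trans r20 rx.
  have q0 : 0 < 4 * sigma ^+ 2 by apply: mulr_gt0 => //; exact: exprn_gt0.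
  have u0 : 0 < u := divr_gt0 xa0 q0.
  have uV : u^-1 <= 4 * sigma ^+ 2 / r ^+ 2.
    by rewrite /u invf_div; apply: ler_wpM2l; [exact: ltW|rewrite lef_pV2].
  have eu : expR (- u) <= u^-1.
    rewrite expRN lef_pV2 ?posrE ?expR_gt0//.
    by apply: le_trans (expR_ge1Dx u); rewrite lerDr.
  have s2 : Num.sqrt 2 <= 2 :> R.
    by rewrite -[leRHS](@ger0_norm _ 2)// -sqrtr_sqr ler_sqrt// ?sqr_ge0//; lra.
  have -> : c = 2 * (4 * sigma ^+ 2 / r ^+ 2) by rewrite /c; field; rewrite gt_eqF.
  by apply: ler_pM; rewrite ?sqrtr_ge0 ?expR_ge0//; exact: le_trans eu uV.
rewrite ge0_integralZl//; last 2 first.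
- by apply/measurable_EFinP; apply: measurable_funTS; exact: measurable_normal_pdf.
- by move=> x _; rewrite lee_fin normal_pdf_ge0.
rewrite -[leRHS]mule1 lee_wpmul2l//.
exact: (probability_le1 (normal_prob a (Num.sqrt 2 * sigma))).
Qed.

(* The center is removed because the resolvent is singular there. *)
Lemma normal_prob_center (a sigma r : R) : 0 < sigma -> 0 < r ->
  ((1 - 8 * sigma ^+ 2 / r ^+ 2)%:E <=
   normal_prob a sigma (sym_itv a r `\` [set a]))%E.
Proof.
move=> s0 r0.
have mI := measurable_sym_itv a r.
have -> : normal_prob a sigma (sym_itv a r `\` [set a]) =
    normal_prob a sigma (sym_itv a r).
  have m1 : measurable ([set a] : set (measurableTypeR R)) by exact: measurable_set1.
  rewrite (measureDI (normal_prob a sigma) mI m1).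
  rewrite [X in (_ + X)%E](_ : _ = 0%E) ?adde0//.
  by apply: normal_prob_finite0; apply: (@sub_finite_set _ _ [set a]) => // x [].
have := normal_prob_tail a s0 r0.
have -> : normal_prob a sigma (~` sym_itv a r) =
    (1 - normal_prob a sigma (sym_itv a r))%E.
  exact: (probability_setC (normal_prob a sigma) mI).
rewrite EFinB; set x := normal_prob a sigma _.
have : x \is a fin_num by rewrite /x fin_num_measure.
case: x => // x _; rewrite -!EFinB !lee_fin; lra.
Qed.

End product_gauss.

(** * The resolvent near an eigenvalue *)

Section complex_limits.
Context (R : realType) (T : Type) (F : set_system T) {FF : Filter F}.
Implicit Types (f g : T -> R[i]) (l m : R[i]).

Definition ccvg_to f l : Prop :=
  (fun t => complex.Re (f t)) @ F --> complex.Re l /\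
  (fun t => complex.Im (f t)) @ F --> complex.Im l.

Lemma ccvg_cst l : ccvg_to (fun=> l) l.
Proof. by split; exact: cvg_cst. Qed.

Lemma ccvgD f g l m : ccvg_to f l -> ccvg_to g m -> ccvg_to (fun t => f t + g t) (l + m).
Proof.
move=> [fr fi] [gr gi]; split; rewrite raddfD; under eq_fun do rewrite raddfD.
  exact: cvgD.
exact: cvgD.
Qed.

Lemma ccvgM f g l m : ccvg_to f l -> ccvg_to g m -> ccvg_to (fun t => f t * g t) (l * m).
Proof.
move=> [fr fi] [gr gi]; split.
  rewrite ReM; under eq_fun do rewrite ReM.
  by apply: cvgB; exact: cvgM.
rewrite ImM; under eq_fun do rewrite ImM.
by apply: cvgD; exact: cvgM.
Qed.

Lemma ccvgB f g l m : ccvg_to f l -> ccvg_to g m -> ccvg_to (fun t => f t - g t) (l - m).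
Proof.
move=> fl gm; apply: ccvgD => //; rewrite -mulN1r; under eq_fun do rewrite -mulN1r.
by apply: ccvgM => //; exact: ccvg_cst.
Qed.

Lemma cvg_sqn f l : ccvg_to f l -> (fun t => sqn (f t)) @ F --> sqn l.
Proof. by move=> [fr fi]; apply: cvgD; apply: cvgM. Qed.

Lemma ccvgV f l : l != 0 -> ccvg_to f l -> ccvg_to (fun t => (f t)^-1) l^-1.
Proof.
move=> l0 fl; have sl : (fun t => (sqn (f t))^-1) @ F --> (sqn l)^-1.
  by apply: cvgV; [rewrite sqn_eq0|exact: cvg_sqn].
have ReV z : complex.Re z^-1 = complex.Re z * (sqn z)^-1 by case: z.
have ImV z : complex.Im z^-1 = - complex.Im z * (sqn z)^-1 by case: z => a b /=; rewrite mulNr.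
case: fl => fr fi; split.
  rewrite ReV; under eq_fun do rewrite ReV.
  exact: cvgM.
rewrite ImV; under eq_fun do rewrite ImV.
by apply: cvgM => //; exact: cvgN.
Qed.

Lemma ccvg_sum (I : Type) (r : seq I) (f : I -> T -> R[i]) (l : I -> R[i]) :
  (forall i, ccvg_to (f i) (l i)) -> ccvg_to (fun t => \sum_(i <- r) f i t) (\sum_(i <- r) l i).
Proof.
move=> fl; elim: r => [|i r IH].
  by rewrite big_nil; under eq_fun do rewrite big_nil; exact: ccvg_cst.
by rewrite big_cons; under eq_fun do rewrite big_cons; exact: ccvgD.
Qed.

Lemma rcvg_sum (I : Type) (r : seq I) (f : I -> T -> R) (l : I -> R) :
  (forall i, f i @ F --> l i) -> (fun t => \sum_(i <- r) f i t) @ F --> \sum_(i <- r) l i.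
Proof.
move=> fl; elim: r => [|i r IH].
  by rewrite big_nil; under eq_fun do rewrite big_nil; exact: cvg_cst.
by rewrite big_cons; under eq_fun do rewrite big_cons; exact: cvgD.
Qed.

End complex_limits.

(** Squares replace discs because the indicator of a square is a product, so planar integrals of
    truncated Gaussians factor into integrals on the line. *)
Definition in_square (R : realType) (r : R) (z0 z : R[i]) : Prop :=
  `|complex.Re z - complex.Re z0| < r /\ `|complex.Im z - complex.Im z0| < r.

Lemma ccvg_square (R : realType) (z0 : R[i]) (f : R[i] -> R) (l c : R) :
  (fun p : R * R => f (p.1 +i* p.2)) @ nbhs (complex.Re z0, complex.Im z0) --> l -> c < l ->
  exists2 r, 0 < r & forall z, in_square r z0 z -> c <= f z.
Proof.
move=> fl cl.
have : \forall p \near nbhs (complex.Re z0, complex.Im z0), c < f (p.1 +i* p.2).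
  exact: (cvgr_gt l fl c cl).
move=> /nbhs_ballP[r /= r0 H]; exists r => // -[a b] [/= ha hb]; apply: ltW.
by apply: (H (a, b)); split; rewrite /ball/= distrC.
Qed.

Lemma common_radius (R : realType) (I : finType) (Q : I -> R -> Prop) :
  (forall i, exists2 r, 0 < r & Q i r) ->
  (forall i r r', r' <= r -> Q i r -> Q i r') ->
  exists2 r, 0 < r & forall i, Q i r.
Proof.
move=> /(_ _)/cid2-/all_sig[r rP] mono.
exists (\big[Num.min/1]_i r i).
  apply: (big_ind (fun x => 0 < x)) => // [x y x0 y0|i _].
    by rewrite lt_min x0.
  exact: (rP i).1.
by move=> i; apply: mono (rP i).2; exact: bigmin_le_cond.
Qed.

Lemma open_square (R : realType) (B : set R[i]) (z0 : R[i]) :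
  open (B : set R[i]^o) -> B z0 ->
  exists2 r, 0 < r & forall z, in_square r z0 z -> B z.
Proof.
move=> oB Bz0; have /nbhs_ballP[e /= e0 H] : nbhs (z0 : R[i]^o) B by exact: open_nbhs_nbhs.
(* The radius of a ball in [R[i]] is itself a complex number, real because it is positive. Half of
   it serves as half-side, since the half-diagonal is then smaller than the radius. *)
have [Ie Re0] : complex.Im e = 0 /\ 0 < complex.Re e.
  by move: e0; rewrite ltcE/= => /andP[/eqP -> ->].
exists (complex.Re e / 2); first by rewrite divr_gt0.
move=> z [hx hy]; apply: H; rewrite /ball/= distrC normc_def.
have -> : e = (complex.Re e)%:C by rewrite [LHS]complexE Ie mulr0 addr0.
rewrite ltcR -[ltRHS](@ger0_norm _ (complex.Re e)) ?ltW// -sqrtr_sqr ltr_sqrt ?exprn_gt0//.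
rewrite !raddfB/=; move: hx hy; set x := _ - _; set y := _ - _ => hx hy.
have q u : `|u| < complex.Re e / 2 -> u ^+ 2 < (complex.Re e / 2) ^+ 2.
  by move=> h; rewrite -[ltLHS]real_normK ?num_real// ltr_pXn2r// nnegrE// divr_ge0// ltW.
have := q _ hx; have := q _ hy; nra.
Qed.

Section local_bound.
Context (R : realType) (n : nat) (M V : 'M[R[i]]_n) (D : 'rV[R[i]]_n).
Hypothesis MVD : distinct_diagonalization M V D.
Let W := invmx V.

(* The squared norm of row [j] of [(M - z)^-1]. *)
Definition res_row (j : 'I_n) (z : R[i]) : R :=
  \sum_k sqn (\sum_l V j l * (D 0 l - z)^-1 * invmx V l k).

(* [|v_i(j)|^2 |w_i|^2]; summed over [j] it is [kappa(lambda_i)^2]. *)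
Definition overlap (j i : 'I_n) : R := sqn (V j i) * \sum_k sqn (invmx V i k).

Lemma overlap_ge0 j i : 0 <= overlap j i.
Proof. by rewrite mulr_ge0 ?sqn_ge0// sumr_ge0// => *; exact: sqn_ge0. Qed.

(** The cofactors along column [j] form row [j] of the adjugate, which is the determinant times the
    inverse [V (D - z)^-1 V^-1]. *)
Lemma sum_sqn_cofactor (j : 'I_n) (z : R[i]) : (forall l, D 0 l != z) ->
  \det (M - z%:M) != 0 /\
  \sum_i sqn (cofactor (M - z%:M) i j) = sqn (\det (M - z%:M)) * res_row j z.
Proof.
move=> Dz; have [Vu _ ->] := MVD.
set N := _ - _; pose d := \row_l (D 0 l - z); pose d' := \row_l (D 0 l - z)^-1.
have NE : N = V *m diag_mx d *m W.
  have -> : diag_mx d = diag_mx D - z%:M.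
    apply/matrixP => a b; rewrite !mxE; case: eqP => // _; by rewrite !mulr0n subr0.
  rewrite mulmxBr mulmxBl /N; congr (_ - _).
  by rewrite mul_mx_scalar -scalemxAl mulmxV// scalemx1.
have dd' : diag_mx d *m diag_mx d' = 1%:M.
  rewrite mulmx_diag -diag_const_mx; congr diag_mx; apply/rowP => l; rewrite !mxE.
  by rewrite divff// subr_eq0.
have NN' : N *m (V *m diag_mx d' *m W) = 1%:M.
  rewrite NE !mulmxA mulmxKV// -(mulmxA V) dd' mulmx1 mulmxV//.
have Nu : N \in unitmx by have [] := mulmx1_unit NN'.
have det0 : \det N != 0 by rewrite -unitfE -unitmxE.
split => //; rewrite /res_row mulr_sumr; apply: eq_bigr => k _; rewrite -sqnM; congr sqn.
transitivity ((\adj N) j k); first by rewrite mxE.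
have -> : \adj N = \det N *: (V *m diag_mx d' *m W).
  have -> : V *m diag_mx d' *m W = invmx N by rewrite -[LHS](mulKmx Nu) NN' mulmx1.
  by rewrite /invmx Nu scalerA divff// scale1r.
rewrite mxE; congr (_ * _); rewrite mxE; apply: eq_bigr => l _.
by rewrite mul_mx_diag !mxE.
Qed.

(** The determinant cancels in the exponent, leaving [1 / (s^2 X)] with [X = res_row j z]. A lower
    bound on [|lambda_i - z|^2 X] thus puts a Gaussian centred at [lambda_i] below the test. *)
Lemma gauss_test_ge (s c : R) (i j : 'I_n) (z : R[i]) : 0 < s -> 0 < c ->
  (forall l, D 0 l != z) -> c <= sqn (D 0 i - z) * res_row j z ->
  expR (- (sqn (D 0 i - z) / (s ^+ 2 * c))) <= gauss_test s j (M - z%:M).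
Proof.
move=> s0 c0 Dz cX; have [det0 SE] := sum_sqn_cofactor j Dz.
rewrite /gauss_test SE.
have q0 : 0 < sqn (D 0 i - z) by rewrite lt_neqAle eq_sym sqn_eq0 subr_eq0 Dz sqn_ge0.
have X0 : 0 < res_row j z by rewrite -(pmulr_rgt0 _ q0); exact: lt_le_trans cX.
have sd : 0 < sqn (\det (M - z%:M)) by rewrite lt_neqAle eq_sym sqn_eq0 det0 sqn_ge0.
rewrite mulf_eq0 !gt_eqF//= ler_expR lerN2.
have -> : sqn (\det (M - z%:M)) / (s ^+ 2 * (sqn (\det (M - z%:M)) * res_row j z)) =
    (s ^+ 2)^-1 * (res_row j z)^-1.
  by field; rewrite !gt_eqF.
rewrite [(s ^+ 2 * c)^-1]invfM [leRHS]mulrCA ler_wpM2l ?invr_ge0 ?sqr_ge0//.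
by rewrite ler_pdivlMr// mulrC ler_pdivrMr.
Qed.

(** Multiplied by [lambda_i - z], the [i]-th term of the resolvent becomes constant and the others
    tend to 0 at [lambda_i]. The function [f], where [phi] is set to 1 at [l = i], is the continuous
    extension, with value [overlap j i] at [lambda_i]; the factor [theta < 1] leaves room for
    continuity. *)
Lemma res_row_near (i j : 'I_n) (theta : R) : 0 < theta < 1 -> 0 < overlap j i ->
  exists2 r, 0 < r & forall z, in_square r (D 0 i) z -> z != D 0 i ->
    theta * overlap j i <= sqn (D 0 i - z) * res_row j z.
Proof.
move=> /andP[th0 th1] K0; have [_ Di _] := MVD.
pose phi l z := if l == i then 1 else (D 0 i - z) * (D 0 l - z)^-1.
pose f z := \sum_k sqn (\sum_l V j l * phi l z * W l k).
pose a := complex.Re (D 0 i); pose b := complex.Im (D 0 i).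
have id_cvg : ccvg_to (nbhs (a, b)) (fun p : R * R => p.1 +i* p.2) (D 0 i).
  by split; [exact: cvg_fst|exact: cvg_snd].
have cphi l : ccvg_to (nbhs (a, b)) (fun p : R * R => phi l (p.1 +i* p.2)) (l == i)%:R.
  rewrite /phi; case: eqVneq => [_|li]; first exact: ccvg_cst.
  have -> : 0%:R = (D 0 i - D 0 i) * (D 0 l - D 0 i)^-1 by rewrite subrr mul0r.
  apply: ccvgM; first by apply: ccvgB => //; exact: ccvg_cst.
  apply: ccvgV; first by rewrite subr_eq0; apply: contra_neq li => /Di.
  by apply: ccvgB => //; exact: ccvg_cst.
have cf : (fun p : R * R => f (p.1 +i* p.2)) @ nbhs (a, b) --> overlap j i.
  have -> : overlap j i = \sum_k sqn (\sum_l V j l * (l == i)%:R * W l k).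
    rewrite /overlap mulr_sumr; apply: eq_bigr => k _; rewrite -sqnM; congr sqn.
    rewrite (bigD1 i)//= eqxx mulr1 big1 ?addr0// => l li.
    by rewrite (negbTE li) mulr0 mul0r.
  apply: rcvg_sum => k; apply: cvg_sqn; apply: ccvg_sum => l.
  apply: ccvgM; last exact: ccvg_cst.
  by apply: ccvgM => //; exact: ccvg_cst.
have [|r r0 H] := ccvg_square cf (c := theta * overlap j i).
  by rewrite gtr_pMl.
exists r => // z zr zD; apply: le_trans (H z zr) _.
rewrite le_eqVlt; apply/orP; left; apply/eqP.
rewrite /f /res_row mulr_sumr; apply: eq_bigr => k _; rewrite -sqnM; congr sqn.
rewrite mulr_sumr; apply: eq_bigr => l _; rewrite /phi.
case: eqVneq => [->|_].
  by rewrite mulrA mulrCA divff ?mulr1// subr_eq0 eq_sym.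
by rewrite [RHS]mulrA; congr (_ * _); rewrite [RHS]mulrCA.
Qed.

End local_bound.

(** * Area integrals of the tests over an open set *)

Definition region (R : realType) (B : set R[i]) : set (measurableTypeR R * measurableTypeR R) :=
  [set p : R * R | B (p.1 +i* p.2)].

(** An open set is the union of the countably many squares with rational centre and half-side that
    it contains. *)
Lemma measurable_region (R : realType) (B : set R[i]) :
  open (B : set R[i]^o) -> measurable (region B).
Proof.
move=> oB.
pose Q (q : rat * rat * rat) :=
  sym_itv (ratr q.1.1) (ratr q.2 : R) `*` sym_itv (ratr q.1.2) (ratr q.2 : R).
pose F q := if pselect (Q q `<=` region B) then Q q else set0.
have -> : region B = \bigcup_q F q.
  apply/seteqP; split => [[x y] Bxy|p [q _]]; last first.
    by rewrite /F; case: pselect => //= QB; exact: QB.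
  have [r r0 H] := open_square oB Bxy.
  (* The centre is within [r / 4 < rho] of the point, so the point is covered; the square reaches at
     most [r / 4 + r / 2 < r] away from it, so it stays in [B]. *)
  have [rho] := @rat_in_itvoo R (r / 4) (r / 2) ltac:(lra).
  have [c] := @rat_in_itvoo R (x - r / 4) (x + r / 4) ltac:(lra).
  have [e] := @rat_in_itvoo R (y - r / 4) (y + r / 4) ltac:(lra).
  rewrite !in_itv/= => /andP[e1 e2] /andP[c1 c2] /andP[h1 h2].
  exists (c, e, rho) => //; rewrite /F; case: pselect => /= [_|[]].
    by split; rewrite /sym_itv/= ltr_distl; apply/andP; split; lra.
  move=> [u v] [/=]; rewrite /sym_itv/= !ltr_distl => /andP[u1 u2] /andP[v1 v2].
  by apply: H; split; rewrite /= ltr_distl; apply/andP; split; lra.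
apply: countable_bigcupT_measurable => [|q]; first exact: countableP.
rewrite /F; case: pselect => //= _.
by apply: measurableX; exact: measurable_sym_itv.
Qed.

Lemma measurable_gauss_test_shift (d : measure_display) (S : measurableType d) (R : realType)
    (s : R) n (j : 'I_n) (N : S -> 'M[R[i]]_n) (x y : S -> R) :
  (forall i k, cmeasurable (fun w => N w i k)) ->
  measurable_fun setT x -> measurable_fun setT y ->
  measurable_fun setT (fun w => gauss_test s j (N w - (x w +i* y w)%:M)).
Proof.
move=> mN mx my; apply: measurable_gauss_test => i k.
under eq_fun do rewrite !mxE; apply: cmeasurableD => //; apply: cmeasurableN.
under eq_fun do rewrite -mulr_natr.
by apply: cmeasurableM; [split|exact: cmeasurable_cst].
Qed.

Section local_integral.
Context (R : realType) (n : nat) (M V : 'M[R[i]]_n) (D : 'rV[R[i]]_n).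
Hypothesis MVD : distinct_diagonalization M V D.
Context (B : set R[i]) (oB : open (B : set R[i]^o)) (j : 'I_n) (theta : R).
Hypothesis theta01 : 0 < theta < 1.
Notation mu := (@lebesgue_measure R).

Let a i := complex.Re (D 0 i).
Let b i := complex.Im (D 0 i).
Let K i := overlap V j i.
(** With this width the product of the two coordinate Gaussians is [exp (- |z - lambda_i|^2 / (s^2
    theta K_i))], the lower bound available for the test. *)
Let sigma s i := s * Num.sqrt (theta * K i / 2).
Let in_B i := (D 0 i \in B) && (0 < K i).
Let bump r s i (p : R * R) : R :=
  gauss_on (a i) (sigma s i) (sym_itv (a i) r `\ a i) p.1 *
  gauss_on (b i) (sigma s i) (sym_itv (b i) r `\ b i) p.2.

Let bump_ge0 r s i p : 0 <= bump r s i p.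
Proof. by apply: mulr_ge0; exact: gauss_on_ge0. Qed.

Let bump_eq0 r s i p : ~ (in_square r (D 0 i) (p.1 +i* p.2) /\ p.1 != a i) -> bump r s i p = 0.
Proof.
move=> H; apply/eqP; rewrite /bump /gauss_on !mulf_eq0 !indicE !pnatr_eq0 !eqb0.
apply: contra_notT H; rewrite !negb_or !negbK.
move=> /andP[/andP[_ /set_mem[h1 h2]] /andP[_ /set_mem[h3 h4]]].
by split; [split|apply/eqP].
Qed.

Let bump_le r s i p : 0 < s -> 0 < K i ->
  bump r s i p <= expR (- (sqn (D 0 i - (p.1 +i* p.2)) / (s ^+ 2 * (theta * K i)))).
Proof.
move=> s0 K0; have /andP[th0 _] := theta01.
have le1 (A : set R) x : \1_A x <= 1 :> R by rewrite indicE; case: (_ \in _).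
apply: (@le_trans _ _ (normal_fun (a i) (sigma s i) p.1 * normal_fun (b i) (sigma s i) p.2)).
  apply: ler_pM; rewrite ?gauss_on_ge0//; apply: ler_piMr => //; exact: normal_fun_ge0.
rewrite /normal_fun -expRD ler_expR le_eqVlt; apply/orP; left; apply/eqP.
rewrite /sigma exprMn sqr_sqrtr; last by rewrite divr_ge0// mulr_ge0// ltW.
rewrite /sqn !raddfB/= -/(a i) -/(b i); field.
by rewrite !gt_eqF.
Qed.

Let dist i l : R := Num.max `|a l - a i| `|b l - b i|.

Let dist_gt0 i l : l != i -> 0 < dist i l.
Proof.
move=> li; have [_ Di _] := MVD; rewrite lt_max !normr_gt0 !subr_eq0 -negb_and.
apply: contra_neqN li => /andP[/eqP h1 /eqP h2]; apply: Di; apply/eqP.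
by move: h1 h2; rewrite /a /b eq_complex => -> ->; rewrite !eqxx.
Qed.

(* The bumps live on disjoint squares around the eigenvalues in [B], on which the
   weight [K i] is lowered to [theta * K i] to absorb the other terms of the resolvent. *)
Lemma bump_sum_le : exists2 r, 0 < r & forall s, 0 < s -> forall p : R * R,
  \sum_(i | in_B i) bump r s i p <=
  gauss_test s j (M - (p.1 +i* p.2)%:M) * \1_(region B) p.
Proof.
have /andP[th0 th1] := theta01.
(* Three demands on the half-side: the resolvent estimate, inclusion in [B], and disjointness of the
   squares. Each persists when [r] shrinks, so finitely many eigenvalues share one radius. *)
pose Q1 i r := 0 < K i -> forall z, in_square r (D 0 i) z -> z != D 0 i ->
    theta * K i <= sqn (D 0 i - z) * res_row V D j z.
pose Q2 i r := B (D 0 i) -> forall z, in_square r (D 0 i) z -> B z.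
pose Q3 i r := forall l, l != i -> 2 * r <= dist i l.
have sqmono r r' z0 z : r' <= r -> in_square r' z0 z -> in_square r z0 z.
  by move=> rr' [h1 h2]; split; apply: lt_le_trans rr'.
have ex1 i : exists2 r, 0 < r & Q1 i r.
  have [K0|K0] := boolP (0 < K i); last by exists 1 => // h; rewrite h in K0.
  by have [r r0 H] := res_row_near MVD theta01 K0; exists r => // _; exact: H.
have ex2 i : exists2 r, 0 < r & Q2 i r.
  have [Bi|Bi] := pselect (B (D 0 i)); last by exists 1 => // /Bi.
  by have [r r0 H] := open_square oB Bi; exists r => // _; exact: H.
have ex3 i : exists2 r, 0 < r & Q3 i r.
  apply: (@common_radius _ _ (fun l r => l != i -> 2 * r <= dist i l)) => [l|l r r' rr' H li].
    have [->|li] := eqVneq l i; first by exists 1.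
    exists (dist i l / 2); first by rewrite divr_gt0// dist_gt0.
    by move=> _; rewrite mulrC divfK.
  by apply: le_trans (H li); rewrite ler_pM2l.
have [r r0 Hr] : exists2 r, 0 < r & forall i, [/\ Q1 i r, Q2 i r & Q3 i r].
  apply: common_radius => [i|i r r' rr' [q1 q2 q3]].
    have [r1 r10 H1] := ex1 i; have [r2 r20 H2] := ex2 i; have [r3 r30 H3] := ex3 i.
    exists (Num.min r1 (Num.min r2 r3)); first by rewrite !lt_min r10 r20 r30.
    split.
    - by move=> K0 z zr; apply: H1 => //; apply: sqmono zr; rewrite ge_min lexx.
    - by move=> Bi z zr; apply: H2 => //; apply: sqmono zr; rewrite !ge_min lexx orbT.
    - by move=> l li; apply: le_trans (H3 l li); rewrite ler_pM2l// !ge_min lexx !orbT.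
  split.
  - by move=> K0 z zr; apply: q1 => //; exact: sqmono zr.
  - by move=> Bi z zr; apply: q2 => //; exact: sqmono zr.
  - by move=> l li; apply: le_trans (q3 l li); rewrite ler_pM2l.
exists r => // s s0 p.
have sep i l z : l != i -> in_square r (D 0 i) z -> in_square r (D 0 l) z -> False.
  move=> li [h1 h2] [h3 h4]; have [_ _ /(_ l li)] := Hr i.
  rewrite leNgt => /negP; apply; rewrite gt_max -/(a i) -/(b i) -/(a l) -/(b l) in h1 h2 h3 h4 *.
  by move: h1 h2 h3 h4; rewrite !ltr_distl => /andP[? ?] /andP[? ?] /andP[? ?] /andP[? ?];
    apply/andP; split; apply/andP; split; lra.
have rhs0 : 0 <= gauss_test s j (M - (p.1 +i* p.2)%:M) * \1_(region B) p.
  by rewrite mulr_ge0 ?gauss_test_ge0// indicE.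
have [[i [/andP[iB K0] [pi pa]]]|none] := pselect (exists i, in_B i /\
    (in_square r (D 0 i) (p.1 +i* p.2) /\ p.1 != a i)); last first.
  rewrite big1// => i iB; apply: bump_eq0 => H; apply: none; by exists i.
have [q1 q2 q3] := Hr i.
have zi : (p.1 +i* p.2) != D 0 i by rewrite eq_complex/= (negbTE pa).
rewrite (bigD1 i)/=; last by rewrite /in_B iB.
rewrite big1 ?addr0; last first.
  by move=> l /andP[_ li]; apply: bump_eq0 => -[pl _]; exact: (sep i l _ li pi pl).
have -> : \1_(region B) p = 1 :> R.
  by rewrite indicE mem_set//; apply: q2 => //; exact: set_mem.
rewrite mulr1; apply: le_trans (bump_le _ _ s0 K0) _.
have c0 : 0 < theta * K i := mulr_gt0 th0 K0.
apply: (gauss_test_ge MVD s0 c0) => [l|].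
  have [->|li] := eqVneq l i; first by rewrite eq_sym.
  (* Were [z] another eigenvalue, it would be the centre of that eigenvalue's square while lying in
     the square of [i]. *)
  apply/eqP => Dl; apply: (sep i l _ li pi); rewrite -Dl; split; by rewrite subrr normr0.
by apply: q1.
Qed.

(** The full plane integral is [2 pi sigma^2 = s^2 pi theta K_i]. Truncation keeps at least a
    fraction [theta] of the mass in each coordinate, whence the third power of [theta]. *)
Let integral_bump r s i : 0 < r -> 0 < s -> 0 < K i ->
  8 * sigma s i ^+ 2 / r ^+ 2 <= 1 - theta ->
  ((s ^+ 2 * pi * (theta ^+ 3 * K i))%:E <= \int[mu \x mu]_p (bump r s i p)%:E)%E.
Proof.
move=> r0 s0 K0 small; have /andP[th0 _] := theta01.
have tK : 0 < theta * K i / 2 by rewrite divr_gt0// mulr_gt0.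
have sg0 : 0 < sigma s i by rewrite mulr_gt0// sqrtr_gt0.
have mA c : measurable (sym_itv c r `\ c).
  by apply: measurableD; [exact: measurable_sym_itv|exact: measurable_set1].
rewrite /bump; under eq_integral do rewrite EFinM.
rewrite (@integral_product_fun _
    (fun x => (gauss_on (a i) (sigma s i) (sym_itv (a i) r `\ a i) x)%:E)
    (fun x => (gauss_on (b i) (sigma s i) (sym_itv (b i) r `\ b i) x)%:E)); first last.
- by move=> x; rewrite lee_fin gauss_on_ge0.
- by move=> x; rewrite lee_fin gauss_on_ge0.
- by apply/measurable_EFinP; exact: measurable_gauss_on.
- by apply/measurable_EFinP; exact: measurable_gauss_on.
rewrite !integral_gauss_on ?gt_eqF//.
have ge c : (theta%:E <= normal_prob c (sigma s i) (sym_itv c r `\ c))%E.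
  by apply: le_trans (normal_prob_center c sg0 r0); rewrite lee_fin; lra.
pose q := (normal_peak (sigma s i))^-1.
have q0 : 0 <= q by rewrite invr_ge0 normal_peak_ge0.
have qq : q * q = s ^+ 2 * pi * (theta * K i).
  rewrite /q /normal_peak invrK -expr2 sqr_sqrtr; last first.
    by rewrite mulrn_wge0// mulr_ge0 ?sqr_ge0 ?pi_ge0.
  by rewrite /sigma exprMn sqr_sqrtr ?(ltW tK)//; field.
rewrite -/q (_ : (_ * _)%:E = ((q * theta)%:E * (q * theta)%:E)%E); last first.
  by rewrite -EFinM; congr _%:E; rewrite [RHS]mulrACA qq; ring.
have qt c : ((q * theta)%:E <= q%:E * normal_prob c (sigma s i) (sym_itv c r `\ c))%E.
  by rewrite EFinM lee_wpmul2l.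
by apply: lee_pmul => //; rewrite lee_fin mulr_ge0// ltW.
Qed.

(** [in_B] leaves out zero overlaps, whose bumps would have width 0; they add nothing to the sum. *)
Let sumK : \sum_(i | in_B i) K i = \sum_(i | D 0 i \in B) K i.
Proof.
rewrite [RHS](bigID (fun i => 0 < K i))/= [X in _ = _ + X]big1 ?addr0// => i /andP[_].
by rewrite -leNgt => K0; apply/le_anti; rewrite K0 overlap_ge0.
Qed.

Lemma overlap_sum_le_near : \forall m \near \oo,
  ((theta ^+ 3 * \sum_(i | D 0 i \in B) overlap V j i)%:E <=
   (m.+1%:R ^+ 2 / pi)%:E * \int[mu \x mu]_(p in region B)
     (gauss_test (m.+1%:R^-1) j (M - (p.1 +i* p.2)%:M))%:E)%E.
Proof.
have /andP[th0 th1] := theta01.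
have [r r0 Hr] := bump_sum_le.
have [e e0 He] : exists2 e : R, 0 < e & forall i, forall s, 0 < s -> s < e ->
    8 * sigma s i ^+ 2 / r ^+ 2 <= 1 - theta.
  apply: common_radius => [i|i e e' ee' H s s0 se]; last first.
    by apply: H => //; exact: lt_le_trans ee'.
  have tK : 0 <= theta * K i / 2 by rewrite divr_ge0// mulr_ge0 ?overlap_ge0 ?ltW.
  have r2 : 0 < r ^+ 2 by rewrite exprn_gt0.
  (* For [s < 1] the quantity to bound, [4 theta K_i s^2 / r^2], is at most [s c]; the summand 1
     keeps [c] positive when [K i = 0]. *)
  pose c := 1 + 4 * theta * K i / r ^+ 2.
  have tKr : 0 <= 4 * theta * K i / r ^+ 2.
    apply: divr_ge0; last exact: ltW.
    by apply: mulr_ge0; [apply: mulr_ge0 => //; exact: ltW|exact: overlap_ge0].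
  have c0 : 0 < c by rewrite /c ltr_pwDl.
  exists (Num.min 1 ((1 - theta) / c)).
    by rewrite lt_min ltr01 divr_gt0// subr_gt0.
  move=> s s0; rewrite lt_min => /andP[s1 sc].
  rewrite /sigma exprMn sqr_sqrtr//.
  have -> : 8 * (s ^+ 2 * (theta * K i / 2)) / r ^+ 2 = s * (s * (4 * theta * K i / r ^+ 2)).
    by field; rewrite gt_eqF.
  have sc' : s * c <= 1 - theta by rewrite -ler_pdivlMr// ltW.
  apply: le_trans sc'; apply: ler_wpM2l; first exact: ltW.
  rewrite /c; apply: (@le_trans _ _ (1 * (4 * theta * K i / r ^+ 2))).
    by apply: ler_wpM2r => //; exact: ltW.
  by rewrite mul1r lerDr.
near=> m; pose s : R := m.+1%:R^-1.
have s0 : 0 < s by rewrite invr_gt0.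
have se : s < e by rewrite /s; near: m; exact: (near_infty_natSinv_lt (PosNum e0)).
rewrite -/s.
have mG : measurable_fun setT (fun p : measurableTypeR R * measurableTypeR R =>
    (gauss_test s j (M - (p.1 +i* p.2)%:M))%:E).
  apply/measurable_EFinP; apply: measurable_gauss_test_shift.
  - by move=> i k; exact: cmeasurable_cst.
  - exact: measurable_fst.
  - exact: measurable_snd.
have mb i : measurable_fun setT (fun p : measurableTypeR R * measurableTypeR R =>
    (bump r s i p)%:E).
  have mA c : measurable (sym_itv c r `\ c).
    by apply: measurableD; [exact: measurable_sym_itv|exact: measurable_set1].
  apply/measurable_EFinP; apply: measurable_funM.
    exact: (measurableT_comp (measurable_gauss_on _ _ (mA _)) measurable_fst).
  exact: (measurableT_comp (measurable_gauss_on _ _ (mA _)) measurable_snd).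
have msum : measurable_fun setT (fun p : measurableTypeR R * measurableTypeR R =>
    (\sum_(i | in_B i) bump r s i p)%:E).
  apply/measurable_EFinP; under eq_fun do rewrite -big_filter.
  by apply: measurable_sum => i; apply/measurable_EFinP; exact: mb.
have low : ((s ^+ 2 * pi * (theta ^+ 3 * \sum_(i | in_B i) K i))%:E <=
    \int[mu \x mu]_(p in region B) (gauss_test s j (M - (p.1 +i* p.2)%:M))%:E)%E.
  apply: (@le_trans _ _ (\int[mu \x mu]_p (\sum_(i | in_B i) bump r s i p)%:E)%E).
    under eq_integral do rewrite -sumEFin -big_filter.
    rewrite ge0_integral_sum//; last by move=> i p _; rewrite lee_fin.
    rewrite big_filter.
    rewrite mulr_sumr mulr_sumr -sumEFin; apply: lee_sum => i /andP[_ K0].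
    by apply: integral_bump => //; exact: He.
  rewrite [leRHS]integral_mkcond; apply: ge0_le_integral => //.
  - by move=> p _; rewrite lee_fin; apply: sumr_ge0 => i _.
  - apply/(measurable_restrictT _ (measurable_region oB)).
    exact: measurable_funTS.
  move=> p _; apply: le_trans
    (_ : _ <= (gauss_test s j (M - (p.1 +i* p.2)%:M) * \1_(region B) p)%:E)%E _.
    by rewrite lee_fin Hr.
  by rewrite patchE indicE; case: ifPn => _; rewrite ?mulr1 ?mulr0.
rewrite -sumK; apply: le_trans (_ : _ <= (m.+1%:R ^+ 2 / pi)%:E *
    (s ^+ 2 * pi * (theta ^+ 3 * \sum_(i | in_B i) K i))%:E)%E _; last first.
  by rewrite lee_wpmul2l// lee_fin divr_ge0 ?sqr_ge0 ?pi_ge0.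
rewrite -EFinM lee_fin le_eqVlt; apply/orP; left; apply/eqP.
have : m.+1%:R != 0 :> R by rewrite pnatr_eq0.
have := lt0r_neq0 (pi_gt0 R).
rewrite /s; move: (m.+1%:R : R) (pi : R) => x c c0 x0; field.
by rewrite x0 c0.
Unshelve. all: by end_near. Qed.

End local_integral.

(** * Condition numbers and the limit of the Gaussian tests *)

Lemma limn_einf_ge (R : realType) (u : (\bar R)^nat) (x : \bar R) :
  (\forall m \near \oo, x <= u m)%E -> (x <= limn_einf u)%E.
Proof.
move=> [N _ H]; rewrite limn_einf_lim; apply: lime_ge; first exact: is_cvg_einfs.
exists N => // m Nm; apply: le_ereal_inf_tmp => _ [k /= mk <-].
by apply: H => /=; exact: leq_trans mk.
Qed.

Lemma limn_einf_le (R : realType) (u : (\bar R)^nat) (x : \bar R) :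
  (forall m, u m <= x)%E -> (limn_einf u <= x)%E.
Proof.
move=> H; rewrite limn_einf_lim; apply: lime_le; first exact: is_cvg_einfs.
apply: nearW => m; apply: le_trans (H m).
by apply: ereal_inf_lbound; exists m => /=.
Qed.

Lemma measurable_fun_limn_einf (d : measure_display) (T : measurableType d) (R : realType)
    (D : set T) (f : (T -> \bar R)^nat) : (forall m, measurable_fun D (f m)) ->
  measurable_fun D (fun x => limn_einf (f ^~ x)).
Proof.
move=> mf; apply: measurableT_comp => //.
apply: (@measurable_fun_limn_esup _ _ _ D (fun m x => - f m x)%E) => m.
exact: measurableT_comp.
Qed.

(* The sum of squared condition numbers is not known to be measurable. *)
Lemma integral_le_nonmeasurable (d : measure_display) (T : measurableType d) (R : realType)
    (mu : {measure set T -> \bar R}) (f g : T -> \bar R) :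
  (forall x, 0 <= f x)%E -> (forall x, f x <= g x)%E ->
  (\int[mu]_x f x <= \int[mu]_x g x)%E.
Proof.
move=> f0 fg; have g0 x : (0 <= g x)%E by exact: le_trans (fg x).
rewrite !ge0_integralTE//; apply: ereal_sup_le => _ [h /= hf <-].
by exists h => // x; exact: le_trans (fg x).
Qed.

(** Cauchy-Schwarz by induction on the list. The real inner product [t] of the new term and the
    partial sum satisfies [t^2 <= (x B) (A y)] by Lagrange's identity, so [2 t <= x B + A y] by the
    inequality of means. *)
Lemma sqn_sum_le (R : realType) (I : Type) (r : seq I) (a b : I -> R[i]) :
  sqn (\sum_(k <- r) a k * b k) <=
  (\sum_(k <- r) sqn (a k)) * (\sum_(k <- r) sqn (b k)).
Proof.
elim: r => [|k r IH]; first by rewrite !big_nil sqn0 mul0r.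
rewrite !big_cons; set s := \sum_(_ <- _) _ * _ in IH *.
set A := \sum_(_ <- _) sqn (a _) in IH *; set B := \sum_(_ <- _) sqn (b _) in IH *.
have A0 : 0 <= A by apply: sumr_ge0 => *; exact: sqn_ge0.
have B0 : 0 <= B by apply: sumr_ge0 => *; exact: sqn_ge0.
have c := sqnM (a k) (b k); move: (sqn_ge0 (a k)) (sqn_ge0 (b k)) c.
move: (sqn (a k)) (sqn (b k)) (a k * b k) => x y p x0 y0 c.
have -> : sqn (p + s) = sqn p + sqn s +
    2 * (complex.Re p * complex.Re s + complex.Im p * complex.Im s).
  by rewrite /sqn !raddfD/=; ring.
set t := complex.Re p * _ + _.
have tt : t ^+ 2 <= (x * B) * (A * y).
  have -> : x * B * (A * y) = (x * y) * (A * B) by ring.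
  apply: (@le_trans _ _ (sqn p * sqn s)); last by rewrite c ler_wpM2l// mulr_ge0.
  rewrite -subr_ge0.
  have -> : sqn p * sqn s - t ^+ 2 =
      (complex.Re p * complex.Im s - complex.Im p * complex.Re s) ^+ 2.
    by rewrite /t /sqn; ring.
  exact: sqr_ge0.
have t2 : 2 * t <= x * B + A * y.
  have [t0|t0] := leP t 0.
    apply: (@le_trans _ _ 0); first by rewrite mulr_ge0_le0.
    by rewrite addr_ge0// mulr_ge0.
  have xB : 0 <= x * B by rewrite mulr_ge0.
  have Ay : 0 <= A * y by rewrite mulr_ge0.
  have t20 : 0 <= 2 * t by rewrite mulr_ge0// ltW.
  rewrite -(@ler_pXn2r _ 2)// ?nnegrE ?addr_ge0//.
  move: tt; move: (x * B) (A * y) => u v tt.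
  rewrite -subr_ge0 (_ : _ - _ = (u - v) ^+ 2 + 4 * (u * v - t ^+ 2)); last by ring.
  by rewrite addr_ge0 ?sqr_ge0// mulr_ge0// subr_ge0.
have -> : (x + A) * (y + B) = x * y + A * B + (x * B + A * y) by ring.
by rewrite c lerD// lerD2l.
Qed.

(** The vector [u *m w *m x] is [u] times the scalar [w *m x], which Cauchy-Schwarz bounds on the
    unit ball. *)
Lemma op_norm_rank_one (R : realType) n (u : 'cV[R[i]]_n) (w : 'rV[R[i]]_n) :
  op_norm (u *m w) ^+ 2 <= (\sum_i sqn (u i 0)) * (\sum_k sqn (w 0 k)).
Proof.
set U := \sum_i _; set W := \sum_k _.
have U0 : 0 <= U by apply: sumr_ge0 => *; exact: sqn_ge0.
have W0 : 0 <= W by apply: sumr_ge0 => *; exact: sqn_ge0.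
pose E := [set euclid_norm (u *m w *m x) | x in [set x : 'cV[R[i]]_n | euclid_norm x <= 1]].
have ub : ubound E (Num.sqrt (U * W)).
  move=> _ [x /= x1 <-]; rewrite /euclid_norm ler_sqrt ?mulr_ge0//.
  have -> : \sum_i (complex.Re ((u *m w *m x) i 0) ^+ 2 + complex.Im ((u *m w *m x) i 0) ^+ 2) =
      U * sqn (\sum_k w 0 k * x k 0).
    rewrite /U mulr_suml; apply: eq_bigr => i _.
    rewrite -/(sqn _) -sqnM; congr sqn.
    by rewrite -mulmxA mxE big_ord1; congr (_ * _); rewrite mxE.
  rewrite ler_wpM2l//; apply: le_trans (sqn_sum_le _ _ _) _.
  rewrite ler_piMr//; move: x1; rewrite /euclid_norm -[X in _ <= X]sqrtr1 ler_sqrt//.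
have E0 : E 0.
  exists 0; rewrite /= /euclid_norm ?mulmx0 big1 ?sqrtr0// => i _;
  by rewrite !mxE expr0n addr0.
have supE0 : 0 <= sup E by apply: ub_le_sup => //; exists (Num.sqrt (U * W)).
have : sup E <= Num.sqrt (U * W) by apply: ge_sup => //; exists 0.
rewrite -[op_norm _]/(sup E) => H.
by rewrite -[leRHS](@sqr_sqrtr _ (U * W)) ?mulr_ge0// ler_pXn2r// nnegrE ?sqrtr_ge0.
Qed.

Section liminf.
Context (R : realType) (n : nat) (M V : 'M[R[i]]_n) (D : 'rV[R[i]]_n).
Hypothesis MVD : distinct_diagonalization M V D.
Context (B : set R[i]) (oB : open (B : set R[i]^o)).
Notation mu := (@lebesgue_measure R).

(** Here [theta = 1 - eta] tends to 1: since [1 - 3 eta <= theta^3], the loss is at most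
    [3 eta S <= e]. The cap [1 / 2] keeps [theta] positive, and [S + 1] avoids dividing by 0. *)
Lemma overlap_sum_le_liminf j :
  ((\sum_(i | D 0 i \in B) overlap V j i)%:E <=
   limn_einf (fun m => (m.+1%:R ^+ 2 / pi)%:E * \int[mu \x mu]_(p in region B)
     (gauss_test (m.+1%:R^-1) j (M - (p.1 +i* p.2)%:M))%:E))%E.
Proof.
set S := \sum_(i | _) _; have S0 : 0 <= S by apply: sumr_ge0 => *; exact: overlap_ge0.
apply/lee_subgt0Pr => e e0.
pose eta := Num.min (1 / 2) (e / (3 * (S + 1))).
have q0 : 0 < 3 * (S + 1) by rewrite mulr_gt0// ltr_wpDl.
have eta0 : 0 < eta by rewrite lt_min !divr_gt0.
have eta1 : eta <= 1 / 2 by rewrite ge_min lexx.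
have etae : 3 * eta * S <= e.
  apply: (@le_trans _ _ (eta * (3 * (S + 1)))); first by nra.
  by rewrite -ler_pdivlMr// ge_min lexx orbT.
have th01 : 0 < 1 - eta < 1 by apply/andP; split; lra.
apply: le_trans (limn_einf_ge (overlap_sum_le_near MVD oB j th01)).
rewrite -EFinB lee_fin -/S.
have : 1 - 3 * eta <= (1 - eta) ^+ 3 by rewrite exprS expr2; nra.
nra.
Qed.

Lemma eig_cond_sum_le :
  (\sum_(i | D 0%R i \in B) eig_cond M (D 0%R i) ^+ 2 <=
   \sum_j limn_einf (fun m => (m.+1%:R ^+ 2 / pi)%:E * \int[mu \x mu]_(p in region B)
     (gauss_test (m.+1%:R^-1) j (M - (p.1 +i* p.2)%:M))%:E))%E.
Proof.
apply: (@le_trans _ _ (\sum_j (\sum_(i | D 0%R i \in B) overlap V j i)%:E)%E); last first.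
  by apply: lee_sum => j _; exact: overlap_sum_le_liminf.
rewrite sumEFin exchange_big -sumEFin; apply: lee_sum => i _ /=.
rewrite (eig_condE _ MVD) -EFinM -expr2 lee_fin.
apply: le_trans (op_norm_rank_one _ _) _.
rewrite /overlap -mulr_suml; under eq_bigr do rewrite mxE.
by under [X in _ * X]eq_bigr do rewrite mxE.
Qed.

End liminf.

(** * Tonelli over sample space and plane, and the conclusion *)

Lemma sigma_finite_plane (R : realType) :
  sigma_finite setT (@lebesgue_measure R \x @lebesgue_measure R)%E.
Proof.
exists (fun m => sym_itv (0 : R) m.+1%:R `*` sym_itv (0 : R) m.+1%:R).
  apply/seteqP; split => // -[x y] _.
  pose m := Num.truncn (Num.max `|x| `|y|).
  have : Num.max `|x| `|y| < m.+1%:R :> R by exact: truncnS_gt.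
  by rewrite gt_max => /andP[hx hy]; exists m => //; split; rewrite /sym_itv/= subr0.
move=> m; have mI := measurable_sym_itv (0 : R) m.+1%:R.
have fI : (lebesgue_measure (sym_itv (0 : R) m.+1%:R) < +oo)%E.
  by rewrite sym_itvE lebesgue_measure_itv/=; case: ifP => _; rewrite ?ltry.
split; first exact: measurableX.
by rewrite product_measure1E// lte_mul_pinfty// ge0_fin_numE.
Qed.

Definition plane_measure (R : realType) :
    {sigma_finite_measure set (measurableTypeR R * measurableTypeR R)%type -> \bar R} :=
  let mixin := Measure_isSigmaFinite.Build _ _ _ (@lebesgue_measure R \x @lebesgue_measure R)%E
    (@sigma_finite_plane R) in
  HB.pack (@lebesgue_measure R \x @lebesgue_measure R)%E mixin.

(** The restriction to [region B] becomes an indicator factor, so Tonelli applies on the whole plane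
    and the bound at fixed [z], being uniform, is multiplied by the area. The measurability part is
    what Fatou's lemma requires later. *)
Lemma expected_overlap_le (d : measure_display) (T : measurableType d) (R : realType)
    (P : probability T R) (n : nat) (hn : (0 < n)%N) (A : 'M[R[i]]_n) (delta : R)
    (G : T -> 'M[R[i]]_n) (B : set R[i]) (j : 'I_n) (s : R) :
  ginibre P G -> 0 < delta -> open (B : set R[i]^o) -> 0 < s ->
  measurable_fun setT (fun w => \int[lebesgue_measure \x lebesgue_measure]_(p in region B)
    (gauss_test s j (A + delta%:C *: G w - (p.1 +i* p.2)%:M))%:E)%E /\
  (\int[P]_w \int[lebesgue_measure \x lebesgue_measure]_(p in region B)
    (gauss_test s j (A + delta%:C *: G w - (p.1 +i* p.2)%:M))%:E <=
   (s ^+ 2 * (n%:R / delta ^+ 2))%:E * vol B)%E.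
Proof.
move=> hG d0 oB s0; have mB := measurable_region oB.
pose S : measurableType _ := (measurableTypeR R * measurableTypeR R)%type.
pose mu2 := plane_measure R.
pose f (q : T * S) :=
  ((gauss_test s j (A + delta%:C *: G q.1 - (q.2.1 +i* q.2.2)%:M))%:E * (\1_(region B) q.2)%:E)%E.
have f0 q : (0 <= f q)%E by rewrite mule_ge0 ?lee_fin ?gauss_test_ge0 ?indicE.
have mf : measurable_fun setT f.
  apply: emeasurable_funM; apply/measurable_EFinP; last first.
    exact: (measurableT_comp (measurable_indic mB) measurable_snd).
  apply: measurable_gauss_test_shift.
  - move=> i k; under eq_fun do rewrite !mxE.
    apply: cmeasurableD; first exact: cmeasurable_cst.
    apply: cmeasurableM; first exact: cmeasurable_cst.
    have [mr mi] := cmeasurable_entry i k (ginibre_measurable hG).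
    split; first exact: (measurableT_comp mr measurable_fst).
    exact: (measurableT_comp mi measurable_fst).
  - exact: (measurableT_comp measurable_fst measurable_snd).
  - exact: (measurableT_comp measurable_snd measurable_snd).
have fE w : (\int[lebesgue_measure \x lebesgue_measure]_(p in region B)
    (gauss_test s j (A + delta%:C *: G w - (p.1 +i* p.2)%:M))%:E = \int[mu2]_p f (w, p))%E.
  rewrite integral_mkcond; apply: eq_integral => p _.
  by rewrite patchE /f indicE; case: ifPn => _; rewrite ?mule1 ?mule0.
under eq_fun do rewrite fE.
split; first exact: (@measurable_fun_fubini_tonelli_F _ _ T S R mu2 f mf f0).
rewrite (@fubini_tonelli _ _ T S R P mu2 f mf f0).
set c := (s ^+ 2 * (n%:R / delta ^+ 2)).
have c0 : 0 <= c by rewrite mulr_ge0 ?sqr_ge0// divr_ge0// sqr_ge0.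
have -> : (c%:E * vol B = \int[mu2]_p (c%:E * (\1_(region B) p)%:E))%E.
  rewrite ge0_integralZl//; last by apply/measurable_EFinP; exact: measurable_indic.
  by rewrite integral_indic// setIT.
apply: ge0_le_integral => //.
- by move=> p _; exact: integral_ge0.
- exact: (@measurable_fun_fubini_tonelli_G _ _ T S R P f mf f0).
- by apply: emeasurable_funM => //; apply/measurable_EFinP; exact: measurable_indic.
move=> p _; rewrite /f/= ge0_integralZr//; first last.
- by move=> w _; rewrite lee_fin gauss_test_ge0.
- apply/measurable_EFinP; apply: measurable_gauss_test_shift => // i k.
  under eq_fun do rewrite !mxE.
  apply: cmeasurableD; first exact: cmeasurable_cst.
  apply: cmeasurableM; first exact: cmeasurable_cst.
  exact: cmeasurable_entry (ginibre_measurable hG).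
by rewrite lee_wpmul2r ?lee_fin//; exact: integral_gauss_test_le.
Qed.

Unset Implicit Arguments.
Set Strict Implicit.
Set Printing Implicit Defensive.

Theorem theorem1p5 (d : measure_display) (T : measurableType d) (R : realType)
    (P : probability T R) (n : nat) (hn : (0 < n)%N)
    (A : 'M[R[i]]_n) (hA : op_norm A <= 1)
    (delta : R) (hdelta : 0 < delta < 1)
    (G : T -> 'M[R[i]]_n) (hG : ginibre P G)
    (lam : T -> 'I_n -> R[i])
    (hlam : forall w, eigenvalues (A + delta%:C *: G w) (lam w))
    (B : set R[i]) (hB : open (B : set R[i]^o)) :
  (\int[P]_w (\sum_(i < n | lam w i \in B)
      eig_cond (A + delta%:C *: G w) (lam w i) ^+ 2)
   <= (n%:R ^+ 2 / (pi * delta ^+ 2))%:E * vol B)%E.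
Proof.
(* [eig_disc] is defined for matrices whose order is a successor. *)
case: n hn A hA G hG lam hlam => // n hn A hA G hG lam hlam.
have /andP[d0 _] := hdelta.
pose c m : R := m.+1%:R ^+ 2 / pi.
have c0 m : 0 <= c m by rewrite divr_ge0 ?sqr_ge0 ?pi_ge0.
pose I j m w := (\int[lebesgue_measure \x lebesgue_measure]_(p in region B)
  (gauss_test (m.+1%:R^-1) j (A + delta%:C *: G w - (p.1 +i* p.2)%:M))%:E)%E.
have s0 m : 0 < m.+1%:R^-1 :> R by rewrite invr_gt0.
have I0 j m w : (0 <= I j m w)%E.
  by apply: integral_ge0 => p _; rewrite lee_fin gauss_test_ge0.
have IP j m := expected_overlap_le hn A j hG d0 hB (s0 m).
pose u j w : \bar R := limn_einf (fun m => (c m)%:E * I j m w)%E.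
have cI0 j m w : (0 <= (c m)%:E * I j m w)%E by rewrite mule_ge0// lee_fin.
have u0 j w : (0 <= u j w)%E by apply: limn_einf_ge; apply: nearW => m.
have mcI j m : measurable_fun setT (fun w => (c m)%:E * I j m w)%E.
  by apply: emeasurable_funM => //; exact: (IP j m).1.
have mu_meas j : measurable_fun setT (u j) by exact: measurable_fun_limn_einf.
pose N := [set w | eig_disc (A + delta%:C *: G w) = 0].
have mN : measurable N := measurable_disc_zero_set _ _ (ginibre_measurable hG).
have PN : P N = 0%E := ginibre_eig_disc_neq0 A hG d0.
(* A measurable majorant: on the null event where the discriminant vanishes it is [+oo], at no cost
   to the integral. *)
pose h w := (\sum_j u j w + (cst +oo%E \_ N) w)%E.
apply: (@le_trans _ _ (\int[P]_w h w)%E).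
  apply: integral_le_nonmeasurable => w.
    by apply: sume_ge0 => i _; exact: sqre_ge0.
  rewrite /h patchE; case: ifPn => wN.
    by rewrite addey ?leey// gt_eqF// (lt_le_trans _ (sume_ge0 _ _))// ?ltNy0.
  rewrite adde0.
  have disc0 : eig_disc (A + delta%:C *: G w) != 0.
    by apply: contraNneq wN => H; exact: mem_set.
  have li := eig_disc_injective (hlam w) disc0.
  have [V MVD] := distinct_diagonalization_eigenvalues (hlam w) li.
  have := eig_cond_sum_le MVD hB.
  under eq_bigl do rewrite mxE.
  by under eq_bigr do rewrite mxE.
rewrite ge0_integralD//; last 4 first.
- by move=> w _; exact: sume_ge0.
- exact: emeasurable_sum.
- by move=> w _; apply: erestrict_ge0 => *; exact: leey.
- by apply/(measurable_restrictT _ mN); exact: measurable_cst.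
have -> : (\int[P]_x (cst +oo \_ N) x = 0)%E.
  rewrite -integral_mkcond; transitivity (+oo * P N)%E; first exact: integral_cst.
  by rewrite PN mule0.
rewrite adde0.
rewrite ge0_integral_sum//.
pose K := (n.+1%:R / (pi * delta ^+ 2))%:E.
have uK j : (\int[P]_w u j w <= K * vol B)%E.
  (* After Fatou each term has the same bound, because [c m] times [s^2] with [s = 1 / (m + 1)] is
     [1 / pi]. *)
  apply: le_trans (fatou P measurableT (mcI j) (fun m w _ => cI0 j m w)) _.
  apply: limn_einf_le => m; rewrite ge0_integralZl//; last 2 first.
  - exact: (IP j m).1.
  - by rewrite lee_fin.
  apply: (@le_trans _ _ ((c m)%:E * (((m.+1%:R^-1) ^+ 2 * (n.+1%:R / delta ^+ 2))%:E * vol B))%E).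
    by rewrite lee_wpmul2l ?lee_fin//; exact: (IP j m).2.
  rewrite muleA -EFinM (_ : c m * _ = n.+1%:R / (pi * delta ^+ 2))//.
  have m0 : m.+1%:R != 0 :> R by rewrite pnatr_eq0.
  have := lt0r_neq0 (pi_gt0 R); rewrite /c; move: (m.+1%:R : R) m0 (n.+1%:R : R) (pi : R).
  by move=> x x0 y z z0; field; rewrite x0 z0 lt0r_neq0.
apply: (@le_trans _ _ (\sum_(j < n.+1) K * vol B)%E); first exact: lee_sum.
rewrite -ge0_sume_distrl; last first.
  by move=> j _; rewrite lee_fin divr_ge0// mulr_ge0 ?pi_ge0 ?sqr_ge0.
by rewrite sumEFin sumr_const card_ord -mulrnAl -mulr_natr -expr2.
Qed.
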